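(* Fix integers $k>j\ge 1$. Then $$\inf\left\{\frac{\lambda_k(\Gamma)}{\lambda_j(\Gamma)} : \Gamma \text{ a compact Dirichlet tree}\right\}=1.$$ Moreover, the infimum is always attained (if, for $j=1$, Dirichlet conditions are also allowed at non-leaf vertices), in the following sense: (i) if $j\ge 2$, then the ratio equals $1$ on an equilateral $k$-star (with Dirichlet conditions at all leaves and the Kirchhoff condition at the center); (ii) if $j=1$, then the value $1$ is attained only on graphs which have a Dirichlet condition at an interior (non-leaf) vertex; in particular it is attained on any equilateral $k$-star with Dirichlet conditions at all its leaves and also at its center vertex.
   Context: A compact metric graph $\Gamma=(\mathcal V,\mathcal E)$ has finitely many vertices and edges; each edge $e$ is identified with an interval $[0,\ell_e]$, $0<\ell_e<\infty$, whose endpoints are attached to vertices; $\Gamma$ is connected as a metric graph. It is a tree if $|\mathcal E|-|\mathcal V|+1=0$. A leaf is a vertex of degree one. $C(\Gamma)$ denotes the continuous functions on $\Gamma$ and $H^1(\Gamma)=\{f\in C(\Gamma): f|_e\in H^1(e)\ \forall e\in\mathcal E\}$. For a finite set $V_D$ of vertices, the Laplacian on $\Gamma$ with Dirichlet conditions at $V_D$ is the self-adjoint operator on $L^2(\Gamma)$ associated with the form $\int_\Gamma f'\overline{g}'\,dx$ on the set of $f\in H^1(\Gamma)$ vanishing on $V_D$; at the vertices outside $V_D$ it satisfies the Kirchhoff condition (continuity, and the sum of the derivatives along all incident edges, all oriented into the vertex, is zero). Its eigenvalues, counted with multiplicity, are $\lambda_1(\Gamma)\le\lambda_2(\Gamma)\le\dots$.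 A compact Dirichlet tree is a compact tree where $V_D$ is exactly the set of leaves. In part (ii), the graphs considered are compact trees for which $V_D$ contains all leaves and possibly also some non-leaf vertices (a degree-two vertex may be placed at any point of an edge for this purpose). An equilateral $k$-star consists of $k$ edges of the same length joined at a common center vertex, their other endpoints being distinct leaves. *)

(* Defs.v *)
From HB Require Import structures.
From mathcomp Require Import all_boot all_order all_algebra.
From mathcomp Require Import complex.
From mathcomp Require Import all_classical all_reals all_analysis.
Set Implicit Arguments.
Unset Strict Implicit.
Unset Printing Implicit Defensive.
Import Order.TTheory GRing.Theory Num.Theory.
Import numFieldNormedType.Exports.
Local Open Scope classical_set_scope.
Local Open Scope ring_scope.
Local Open Scope complex_scope.

Definition adjacent (V E : finType) (src tgt : E -> V) : rel V :=
  fun u v => [exists e, ((src e == u) && (tgt e == v))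
                     || ((src e == v) && (tgt e == u))].

(* The edge e is the interval [0, len e], with 0 attached to src e and len e
   attached to tgt e; the orientation is only a choice of coordinate.  Loops
   and multiple edges are allowed. *)
Record metric_graph (R : realType) := MetricGraph {
  vertex : finType;
  edge : finType;
  src : edge -> vertex;
  tgt : edge -> vertex;
  len : edge -> R;
  len_gt0 : forall e, 0 < len e;
  graph_connected : forall u v, connect (adjacent src tgt) u v
}.

Section Graph.
Context {R : realType} (G : metric_graph R).

(* |E| - |V| + 1 = 0 *)
Definition is_tree : bool := (#|edge G| + 1 == #|vertex G|)%N.

(* A loop counts twice. *)
Definition degree (v : vertex G) : nat :=
  (#|[set e : edge G | src e == v]%SET| + #|[set e : edge G | tgt e == v]%SET|)%N.

Definition leaves : {set vertex G} := [set v | degree v == 1%N]%SET.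

End Graph.

Section Interval.
Context {R : realType}.
Local Notation mu := (@lebesgue_measure R).

Definition cintegral (D : set R) (h : R -> R[i]) : R[i] :=
  (\int[mu]_(x in D) complex.Re (h x)) +i* (\int[mu]_(x in D) complex.Im (h x)).

Definition real_L2 (D : set R) (u : R -> R) : Prop :=
  measurable_fun D u /\ mu.-integrable D (EFin \o (fun x => u x ^+ 2)).

Definition L2 (D : set R) (h : R -> R[i]) : Prop :=
  real_L2 D (fun x => complex.Re (h x)) /\ real_L2 D (fun x => complex.Im (h x)).

(* f belongs to H^1(0, l), with derivative df: H^1(0, l) consists of the
   absolutely continuous functions on [0, l] with derivative in L^2, i.e. of
   the primitives of L^2 functions.  Such an f is determined on [0, l] only,
   and df only up to a null set. *)
Definition H1_deriv (l : R) (f df : R -> R[i]) : Prop :=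
  L2 `[0, l] df /\
  forall x, 0 <= x <= l -> f x = f 0 + cintegral `[0, x] df.

End Interval.

Section Laplacian.
Context {R : realType} (G : metric_graph R).

(* f e x is the value at the point x of the edge e; only 0 <= x <= len e
   is meaningful. *)
Definition graph_fun := edge G -> R -> R[i].

Definition graph_L2 (f : graph_fun) : Prop := forall e, L2 `[0, len e] (f e).

Definition graph_inner (f g : graph_fun) : R[i] :=
  \sum_(e : edge G) cintegral `[0, len e] (fun x => f e x * (g e x)^*).

Definition vertex_values (f : graph_fun) (phi : vertex G -> R[i]) : Prop :=
  forall e, f e 0 = phi (src e) /\ f e (len e) = phi (tgt e).

(* f is in H^1(G), vanishes on VD and has derivative df.  As each f e is
   automatically continuous, continuity on G reduces to the existence of
   common values at the vertices. *)
Definition H1_dirichlet (VD : {set vertex G}) (f df : graph_fun) : Prop :=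
  (forall e, H1_deriv (len e) (f e) (df e)) /\
  exists2 phi, vertex_values f phi & forall v, v \in VD -> phi v = 0.

(* The graph of the self-adjoint operator associated with the form
   int f' conj(g'): f is in its domain and is sent to h. *)
Definition laplacian (VD : {set vertex G}) (f h : graph_fun) : Prop :=
  graph_L2 h /\
  exists2 df, H1_dirichlet VD f df &
    forall g dg, H1_dirichlet VD g dg -> graph_inner df dg = graph_inner h g.

Definition eigenfunction (VD : {set vertex G}) (lam : R) (f : graph_fun) : Prop :=
  (exists e x, 0 <= x <= len e /\ f e x != 0) /\
  laplacian VD f (fun e x => lam%:C * f e x).

Definition lin_indep (n : nat) (f : 'I_n -> graph_fun) : Prop :=
  forall c : 'I_n -> R[i],
    (forall e x, 0 <= x <= len e -> \sum_(i < n) c i * f i e x = 0) ->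
    forall i, c i = 0.

(* The eigenvalues in A have total multiplicity at least n, i.e. the sum of
   their eigenspaces has dimension at least n. *)
Definition multiplicity_ge (VD : {set vertex G}) (A : set R) (n : nat) : Prop :=
  exists2 f : 'I_n -> graph_fun, lin_indep f &
    forall i, exists2 lam, A lam & eigenfunction VD lam (f i).

(* lam is the k-th eigenvalue (k >= 1), counted with multiplicity: fewer than
   k eigenvalues are < lam and at least k are <= lam. *)
Definition kth_eigenvalue (VD : {set vertex G}) (k : nat) (lam : R) : Prop :=
  multiplicity_ge VD [set x | x <= lam] k /\
  ~ multiplicity_ge VD [set x | x < lam] k.

Definition eigenvalue_ratio (VD : {set vertex G}) (k j : nat) (r : R) : Prop :=
  exists lk lj,
    [/\ kth_eigenvalue VD k lk, kth_eigenvalue VD j lj & r = lk / lj].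

End Laplacian.

Definition dirichlet_tree_ratios (R : realType) (k j : nat) : set R :=
  [set r | exists2 G : metric_graph R,
     is_tree G & eigenvalue_ratio (leaves G) k j r].

Section Star.
Context {R : realType} (k : nat) (l : R) (l_gt0 : 0 < l).

(* The center is None, and Some i is the outer endpoint of the edge i. *)
Definition star_src (i : 'I_k) : option 'I_k := None.
Definition star_tgt (i : 'I_k) : option 'I_k := Some i.

Lemma star_connected (u v : option 'I_k) :
  connect (adjacent star_src star_tgt) u v.
Proof.
have to_center w : connect (adjacent star_src star_tgt) w None.
  case: w => [i|]; last exact: connect0.
  by apply: connect1; apply/existsP; exists i; rewrite /star_src /star_tgt !eqxx orbT.
have from_center w : connect (adjacent star_src star_tgt) None w.
  case: w => [i|]; last exact: connect0.
  by apply: connect1; apply/existsP; exists i; rewrite /star_src /star_tgt !eqxx.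
exact: connect_trans (to_center u) (from_center v).
Qed.

Definition star : metric_graph R :=
  MetricGraph (fun _ : 'I_k => l_gt0) star_connected.

End Star.

(* Main.v *)
(** An eigenfunction of eigenvalue [w ^+ 2] is, on every edge, a combination of
    [cos (w t)] and [sin (w t)]: testing the weak equation against truncated
    sines [sin (w (t - s))] on [t >= s] yields a linear relation between the
    values at any two points.  When [w * len e < pi] for all edges, the
    eigenvalue problem reduces to the kernel of the Dirichlet-to-Neumann form,
    a quadratic form on the vertex values with negative off-diagonal terms.

    On stars this gives the spectrum below [(pi / l) ^+ 2], [l] being the
    length of the longest edges: it is the unique zero of a decreasing sum of
    cotangents.  For [j = 1], [k] edges of length [pi] together with one short
    edge have [lambda_2 = ... = lambda_k = 1] while [lambda_1] tends to 1 as
    the short edge shrinks.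

    Conversely, the first eigenvalue [w ^+ 2] of a Dirichlet tree is simple.
    If the form were not positive semidefinite at some smaller frequency, then
    minimizing the frequency by compactness would produce a smaller eigenvalue;
    hence the form is positive semidefinite at [w], and the absolute value of a
    kernel vector is again a kernel vector.  Therefore an eigenfunction vanishing
    at an interior vertex vanishes identically. *)

Require Import Defs.
From mathcomp Require Import all_boot all_order all_algebra.
From mathcomp Require Import complex.
From mathcomp Require Import all_classical all_reals all_analysis.
From mathcomp Require Import measurable_realfun ring lra.
Set Implicit Arguments.
Unset Strict Implicit.
Unset Printing Implicit Defensive.
Import Order.TTheory GRing.Theory Num.Theory.
Import numFieldNormedType.Exports.
Local Open Scope classical_set_scope.
Local Open Scope ring_scope.

(** * Integrals and primitives on an interval *)

Section IntervalIntegrals.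
Context {R : realType}.
Local Notation mu := (@lebesgue_measure R).
Implicit Types (f g u v du dv : R -> R) (a b c l s w A B : R).

Definition integ a b f := mu.-integrable `[a, b] (EFin \o f).

Lemma integ_sub a b c d f : a <= c -> d <= b -> integ a b f -> integ c d f.
Proof.
move=> ac db; apply: integrableS => //.
by apply: subset_itv; rewrite bnd_simp.
Qed.

Lemma integD a b f g : integ a b f -> integ a b g ->
  integ a b (fun x => f x + g x).
Proof. by move=> fi gi; have := @integrableD _ _ R mu _ (measurable_itv _) _ _ fi gi. Qed.

Lemma integZ a b c f : integ a b f -> integ a b (fun x => c * f x).
Proof. by move=> fi; have := @integrableZl _ _ R mu _ (measurable_itv _) c _ fi. Qed.

Lemma integ_norm a b f : integ a b f -> integ a b (fun x => `|f x|).
Proof. by move=> fi; have := integrable_norm fi. Qed.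

Lemma integ_continuous a b f : {within `[a, b], continuous f} -> integ a b f.
Proof. exact/continuous_compact_integrable/segment_compact. Qed.

Lemma integ_dom a b f g : measurable_fun `[a, b] f ->
  (forall x, a <= x <= b -> `|f x| <= g x) -> integ a b g -> integ a b f.
Proof.
move=> mf fg gi; apply: le_integrable gi => //; first exact/measurable_EFinP.
move=> x /=; rewrite in_itv /= => xab; rewrite lee_fin.
by apply: le_trans (fg _ xab) _; exact: ler_norm.
Qed.

Lemma integ_cst a b c : integ a b (fun=> c).
Proof. by apply: integ_continuous => x; exact: cvg_cst. Qed.

Lemma integ_measurable a b f : integ a b f -> measurable_fun `[a, b] f.
Proof. by move/measurable_int/measurable_EFinP. Qed.

(** A continuous factor is bounded on the compact interval, so the product is dominated by a
    multiple of [|f|]. *)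
Lemma integM_continuous a b f g : {within `[a, b], continuous g} ->
  integ a b f -> integ a b (fun x => f x * g x).
Proof.
move=> cg fi.
have mg := integ_measurable (integ_continuous cg).
have /compact_bounded [M [_ Mb]] := continuous_compact cg (@segment_compact R a b).
apply: (@integ_dom _ _ _ (fun x => (`|M| + 1) * `|f x|)).
- by apply: measurable_funM => //; exact: integ_measurable.
- move=> x xab; rewrite normrM mulrC ler_wpM2r//.
  apply: Mb; first by rewrite ltr_pwDr// ler_norm.
  by exists x => //=; rewrite in_itv.
- exact/integZ/integ_norm.
Qed.

Lemma Rint_split a b f s : a <= s <= b -> integ a b f ->
  \int[mu]_(x in `[a, b]) f x =
  \int[mu]_(x in `[a, s]) f x + \int[mu]_(x in `[s, b]) f x.
Proof.
move=> /andP[as_ sb] fi; have := Rintegral_itvB fi (x := s).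
rewrite !bnd_simp => /(_ as_ sb) e; rewrite Rintegral_itv_obnd_cbnd in e.
  by rewrite -e; lra.
by apply: integrableS fi => //; apply: subset_itv; rewrite bnd_simp.
Qed.

Lemma le_norm_Rint a b f g : integ a b f -> integ a b g ->
  (forall x, a <= x <= b -> `|f x| <= g x) ->
  `|\int[mu]_(x in `[a, b]) f x| <= \int[mu]_(x in `[a, b]) g x.
Proof.
move=> fi gi fg; apply: le_trans (le_normr_Rintegral _ fi) _ => //.
by apply: le_Rintegral => //; first exact: integ_norm.
Qed.

Lemma Rint_cst a b c : a <= b -> \int[mu]_(x in `[a, b]) c = c * (b - a).
Proof.
move=> ab; rewrite Rintegral_cst//= lebesgue_measure_itv /= lte_fin.
by case: ltgtP ab => //= -> _; rewrite subrr.
Qed.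

Lemma eq_Rint a b f g : (forall x, a <= x <= b -> f x = g x) ->
  \int[mu]_(x in `[a, b]) f x = \int[mu]_(x in `[a, b]) g x.
Proof. by move=> fg; apply: eq_Rintegral => x; rewrite inE /= in_itv /= => /fg. Qed.

Lemma RintD a b f g : integ a b f -> integ a b g ->
  \int[mu]_(x in `[a, b]) (f x + g x) =
  \int[mu]_(x in `[a, b]) f x + \int[mu]_(x in `[a, b]) g x.
Proof. by move=> *; apply: RintegralD. Qed.

Lemma RintZ a b c f : integ a b f ->
  \int[mu]_(x in `[a, b]) (c * f x) = c * \int[mu]_(x in `[a, b]) f x.
Proof. by move=> *; apply: RintegralZl. Qed.

(* [u] is absolutely continuous on [a, b] with derivative [du]. *)
Definition primitive a b u du :=
  integ a b du /\
  forall x, a <= x <= b -> u x = u a + \int[mu]_(t in `[a, x]) du t.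

Lemma primitive_itv a b u du x y : primitive a b u du ->
  a <= x -> x <= y -> y <= b -> u y - u x = \int[mu]_(t in `[x, y]) du t.
Proof.
move=> [dui ue] ax xy yb.
rewrite (ue y) ?(ue x) ?ax ?yb ?(le_trans ax xy) ?(le_trans xy yb)//.
rewrite (@Rint_split a y du x) ?ax//; first by lra.
exact: integ_sub dui.
Qed.

Lemma primitive_sub a b u du x y : primitive a b u du ->
  a <= x -> x <= y -> y <= b -> primitive x y u du.
Proof.
move=> pu ax xy yb; split; first exact: integ_sub (pu.1).
move=> z /andP[xz zy]; rewrite -(primitive_itv pu) ?(le_trans zy)//.
by rewrite addrC subrK.
Qed.

Lemma primitive_continuous a b u du : a <= b -> primitive a b u du ->
  {within `[a, b], continuous u}.
Proof.
move=> ab [dui ue].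
apply: (@subspace_eq_continuous _ _ _
   (fun x => u a + \int[mu]_(t in `[a, x]) du t)).
  by move=> x; rewrite inE /= in_itv /= => /ue /esym.
move=> x; apply: cvgD; first exact: cvg_cst.
have := parameterized_integral_continuous ab dui => /(_ x).
exact.
Qed.

Lemma primitive_derive a b u du : a <= b ->
  (forall x : R, is_derive x (1 : R) u (du x)) -> {within `[a, b], continuous du} ->
  primitive a b u du.
Proof.
move=> ab hd cdu.
have cu : continuous u.
  by move=> x; apply: differentiable_continuous; apply/derivable1_diffP; case: (hd x).
split; first exact: integ_continuous.
move=> x /andP[]; rewrite le_eqVlt => /predU1P[<- _|ax xb].
  by rewrite set_itv1 Rintegral_set1 addr0.
rewrite /Rintegral (@continuous_FTC2 _ du u)//=; first by rewrite [RHS]addrC subrK.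
- by apply: continuous_subspaceW cdu; apply: subset_itvl; rewrite bnd_simp.
- split.
  + by move=> y _; case: (hd y).
  + by apply: cvg_at_right_filter; exact: cu.
  + by apply: cvg_at_left_filter; exact: cu.
- by move=> y _; rewrite derive1E; have ? := hd y; rewrite derive_val.
Qed.

(** The difference quotient of [F] at [x] is at most [K * |V y - V x|], which tends to 0 by mere
    continuity of [V]. In the application [V] is the integral of [|du|]. *)
Lemma is_derive0_squeeze a b (F V : R -> R) K x :
  (forall y, y \in `[a, b] -> `|F y - F x| <= K * `|y - x| * `|V y - V x|) ->
  {within `[a, b], continuous V} -> x \in `]a, b[ -> is_derive x (1 : R) F 0.
Proof.
move=> FV cV xab.
have ab : a < b by move: xab; rewrite in_itv /= => /andP[]; exact: lt_trans.
have cs : h + x @[h --> (0 : R)^'] --> x.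
  rewrite -[X in _ --> X]add0r; apply: cvgD; last exact: cvg_cst.
  exact: cvg_within.
have cVx : V (h + x) @[h --> (0 : R)^'] --> V x.
  apply: (cvg_comp _ _ cs).
  by move: cV => /(continuous_within_itvP _ ab)[+ _ _]; exact.
suff cv : h^-1 *: ((F \o shift x) (h *: (1 : R)) - F x) @[h --> 0^'] --> (0 : R).
  apply: DeriveDef; first by apply/cvg_ex; exists 0.
  exact: cvg_lim cv.
apply/cvgrPdist_le => e e0.
have K1 : 0 < `|K| + 1 by rewrite ltr_pwDr.
have e1 : 0 < e / (`|K| + 1) by apply: divr_gt0.
move/cvgrPdist_le : cVx => /(_ _ e1) cVx.
near=> h.
have hn0 : h != 0 by near: h; exact: nbhs_dnbhs_neq.
have hab : h + x \in `[a, b].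
  by apply: subset_itv_oo_cc; near: h; exact: (cs _ (near_in_itvoo xab)).
have := FV _ hab.
rewrite sub0r normrN addrK => FF /=.
rewrite [_ *: 1]mulr1 normrM normfV ler_pdivrMl ?normr_gt0//.
apply: le_trans FF _; rewrite [K * _]mulrC -mulrA ler_wpM2l//.
have Ve : `|V x - V (h + x)| <= e / (`|K| + 1) by near: h.
move: Ve; rewrite distrC ler_pdivlMr// mulrC; apply: le_trans.
by rewrite ler_wpM2r// (le_trans (ler_norm _))// lerDl.
Unshelve. all: by end_near. Qed.

(* The integral of [h = du phi + u dphi - (u phi)'] over [x, y] is
   [O((y - x) int_x^y |du|)], so its primitive has derivative 0 everywhere. *)
Lemma primitive_by_parts a b u du (phi dphi : R -> R) (C : R) : a <= b ->
  primitive a b u du -> (forall x : R, is_derive x (1 : R) phi (dphi x)) ->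
  continuous dphi -> (forall x, `|dphi x| <= C) ->
  \int[mu]_(x in `[a, b]) (du x * phi x) =
  u b * phi b - u a * phi a - \int[mu]_(x in `[a, b]) (u x * dphi x).
Proof.
move=> ab pu hd cdphi bC.
have cphi : continuous phi.
  by move=> x; apply: differentiable_continuous; apply/derivable1_diffP; case: (hd x).
have wcphi x y : {within `[x, y], continuous phi} by exact: continuous_subspaceT.
have wcdphi x y : {within `[x, y], continuous dphi} by exact: continuous_subspaceT.
have dui := pu.1.
have ui : integ a b u by exact/integ_continuous/primitive_continuous/pu.
have pphi x y : x <= y -> primitive x y phi dphi by move=> xy; exact: primitive_derive.
have i1 : integ a b (fun x => du x * phi x) by exact: integM_continuous.
have i2 : integ a b (fun x => u x * dphi x) by exact: integM_continuous.
pose F x := \int[mu]_(t in `[a, x]) (du t * phi t + u t * dphi t) - u x * phi x.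
pose V x := \int[mu]_(t in `[a, x]) `|du t|.
have Fdiff x y : a <= x -> x <= y -> y <= b ->
    `|F y - F x| <= 2 * C * (y - x) * (V y - V x).
  move=> ax xy yb.
  have sub f : integ a b f -> integ x y f by exact: integ_sub.
  (* The increment of [u phi] is [(u y - u x) * phi y + u x * (phi y - phi x)]; distributing it
     under the integral leaves a small difference in each summand. *)
  have e1 : F y - F x = \int[mu]_(t in `[x, y])
      (du t * (phi t - phi y) + (u t - u x) * dphi t).
    rewrite /F (@Rint_split a y _ x) ?ax//; last first.
      by apply: (@integ_sub a b) => //; apply: integD.
    rewrite [RHS](eq_Rint (g := fun t => (du t * phi t + u t * dphi t) +
      ((- phi y) * du t + (- u x) * dphi t))); last by move=> t _; ring.
    have i3 : integ x y (fun t => du t * phi t + u t * dphi t).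
      by apply: sub; apply: integD.
    have i4 : integ x y dphi by exact: integ_continuous.
    rewrite [RHS]RintD //; last by apply: integD; apply: integZ => //; exact: sub.
    rewrite [X in _ = _ + X]RintD; [|by apply: integZ; exact: sub|exact: integZ].
    rewrite !RintZ//; last exact: sub.
    rewrite -(primitive_itv pu)// -(primitive_itv (pphi _ _ xy))//.
    ring.
  have e2 : V y - V x = \int[mu]_(t in `[x, y]) `|du t|.
    rewrite /V (@Rint_split a y _ x) ?ax//; first by lra.
    by apply: (@integ_sub a b) => //; exact: integ_norm.
  rewrite e1 e2.
  have C0 : 0 <= C by apply: le_trans (bC 0).
  have phib t : x <= t <= y -> `|phi t - phi y| <= C * (y - x).
    move=> /andP[xt ty]; rewrite distrC (primitive_itv (pphi _ _ ty))//.
    apply: le_trans (le_norm_Rint (g := fun=> C) _ _ _) _ => //.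
    - exact: integ_continuous.
    - exact: integ_cst.
    - by rewrite Rint_cst// ler_wpM2l// lerB.
  have ub t : x <= t <= y -> `|u t - u x| <= \int[mu]_(t in `[x, y]) `|du t|.
    move=> /andP[xt ty]; rewrite (primitive_itv pu)//; last exact: le_trans yb.
    have nt : integ x y (fun t => `|du t|) by apply: sub; exact: integ_norm.
    rewrite (@Rint_split x y _ t) ?xt//; apply: ler_wpDr.
      by apply: Rintegral_ge0.
    apply: le_norm_Rint => //.
      by apply: integ_sub dui => //; exact: le_trans yb.
    by apply: integ_sub nt.
  set I := \int[mu]_(t in `[x, y]) `|du t|.
  have i5 : integ x y (fun t => (C * (y - x)) * `|du t| + C * I).
    apply: integD; last exact: integ_cst.
    by apply: integZ; apply: sub; exact: integ_norm.
  apply: le_trans (le_norm_Rint (g := fun t => (C * (y - x)) * `|du t| + C * I) _ _ _) _.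
  - apply: integD.
      apply: integM_continuous; last exact: sub.
      by move=> t; apply: cvgB; [exact: wcphi|exact: cvg_cst].
    apply: integM_continuous => //.
    have [ui' ci] : integ x y u /\ integ x y (fun=> - u x).
      by split; [exact: sub|exact: integ_cst].
    exact: integD.
  - exact: i5.
  - move=> t txy; apply: le_trans (ler_normD _ _) _; rewrite !normrM.
    apply: lerD; first by rewrite mulrC ler_wpM2r// phib.
    by rewrite mulrC; apply: ler_pM => //; exact: ub.
  - rewrite RintD; [|by apply: integZ; apply: sub; exact: integ_norm|exact: integ_cst].
    rewrite RintZ; last by apply: sub; exact: integ_norm.
    rewrite Rint_cst// -/I le_eqVlt; apply/orP; left; apply/eqP; ring.
have [{ab}ab|ba|<-] := ltgtP a b; last first.
- by rewrite set_itv1 !Rintegral_set1; ring.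
- by move: ab; rewrite leNgt ba.
have Vmono x y : a <= x -> x <= y -> y <= b -> V x <= V y.
  move=> ax xy yb; rewrite /V (@Rint_split a y _ x) ?ax//.
    by rewrite lerDl; apply: Rintegral_ge0.
  by apply: (@integ_sub a b) => //; exact: integ_norm.
have cV : {within `[a, b], continuous V}.
  by apply: parameterized_integral_continuous (ltW ab) (integ_norm dui).
have C0 : 0 <= C by apply: le_trans (bC 0).
have Fdiff' x y : x \in `[a, b] -> y \in `[a, b] ->
    `|F y - F x| <= 2 * C * `|y - x| * `|V y - V x|.
  rewrite !in_itv /= => /andP[ax xb] /andP[ay yb].
  wlog xy : x y ax ay xb yb / x <= y => [H|].
    case: (leP x y) => [|/ltW] xy; first exact: H.
    by rewrite distrC (distrC y) (distrC (V y)); exact: H.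
  by rewrite (ger0_norm (_ : 0 <= y - x)) ?(ger0_norm (_ : 0 <= V y - V x))
     ?subr_ge0 ?Vmono// Fdiff.
have cF : {within `[a, b], continuous F}.
  move=> x; apply: cvgB; last first.
    by apply: cvgM; [exact: (primitive_continuous (ltW ab) pu)|exact: wcphi].
  by apply: (parameterized_integral_continuous (ltW ab)); exact: integD.
have dF x : x \in `]a, b[ -> is_derive x (1 : R) F 0.
  move=> xab; apply: (is_derive0_squeeze (K := 2 * C) _ cV xab).
  by move=> y yab; apply: Fdiff' => //; exact: subset_itv_oo_cc.
have [c _ Fc] := MVT ab dF cF.
have : F b - F a = 0 by rewrite Fc mul0r.
rewrite /F set_itv1 Rintegral_set1 RintD//; lra.
Qed.
End IntervalIntegrals.

(** * Functions in H^1 of an interval *)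

Section Sobolev.
Context {R : realType}.
Local Notation mu := (@lebesgue_measure R).
Implicit Types (f g u v du dv : R -> R) (a b c l s w A B : R).

Lemma real_L2_integ l u : real_L2 `[0, l] u -> integ 0 l u.
Proof.
move=> [mu_ iu]; apply: (@integ_dom _ _ _ _ (fun x => 1 + u x ^+ 2)) => //.
  by move=> x _; rewrite ler_norml; apply/andP; split; nra.
by apply: integD => //; exact: integ_cst.
Qed.

Lemma real_L2_mul l u v : real_L2 `[0, l] u -> real_L2 `[0, l] v ->
  integ 0 l (fun x => u x * v x).
Proof.
move=> [mu_ iu] [mv iv]; apply: (@integ_dom _ _ _ _ (fun x => u x ^+ 2 + v x ^+ 2)).
- exact: measurable_funM.
- by move=> x _; rewrite ler_norml; apply/andP; split; nra.
- exact: integD.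
Qed.

Lemma real_L2_comb l a b u v : real_L2 `[0, l] u -> real_L2 `[0, l] v ->
  real_L2 `[0, l] (fun x => a * u x + b * v x).
Proof.
move=> lu lv; have [[mu_ iu] [mv iv]] := (lu, lv); split.
  by apply: measurable_funD; apply: measurable_funM.
have i3 : integ 0 l (fun x => a ^+ 2 * u x ^+ 2 + b ^+ 2 * v x ^+ 2 +
    2 * a * b * (u x * v x)).
  by apply: integD; [apply: integD; exact: integZ|apply: integZ; exact: real_L2_mul].
by apply: eq_integrable i3 => //= x _; congr EFin; ring.
Qed.

Lemma eq_real_L2 (D : set R) u v : u =1 v -> real_L2 D u -> real_L2 D v.
Proof. by move=> /funext ->. Qed.

Lemma real_L2_continuous l u : {within `[0, l], continuous u} -> real_L2 `[0, l] u.
Proof.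
move=> cu; split; first by apply: integ_measurable; exact: integ_continuous.
exact: (integM_continuous cu (integ_continuous cu)).
Qed.

Lemma real_L2_restrict l u (P : set R) : measurable P -> real_L2 `[0, l] u ->
  real_L2 `[0, l] (u \_ P).
Proof.
move=> mP [mu_ iu].
have mr : measurable_fun `[0, l] (u \_ P).
  by apply/measurable_restrict => //; apply: measurable_funS mu_ => //; exact: subIsetr.
split => //.
apply: (@integ_dom _ _ _ _ (fun x => u x ^+ 2)) => //.
  exact: measurable_funX.
move=> x _; rewrite patchE; case: ifP => _; first by rewrite ger0_norm ?sqr_ge0.
by rewrite expr0n /= normr0 sqr_ge0.
Qed.

Definition rH1 l u du :=
  real_L2 `[0, l] du /\
  forall x, 0 <= x <= l -> u x = u 0 + \int[mu]_(t in `[0, x]) du t.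

Lemma rH1_primitive l u du : rH1 l u du -> primitive 0 l u du.
Proof. by move=> [/real_L2_integ]. Qed.

Lemma rH1_L2 l u du : 0 <= l -> rH1 l u du -> real_L2 `[0, l] u.
Proof. by move=> l0 /rH1_primitive/(primitive_continuous l0)/real_L2_continuous. Qed.

Lemma rH1_comb l a b u v du dv : rH1 l u du -> rH1 l v dv ->
  rH1 l (fun x => a * u x + b * v x) (fun x => a * du x + b * dv x).
Proof.
move=> hu hv; have [[lu ue] [lv ve]] := (hu, hv); split.
  exact: real_L2_comb.
move=> x /andP[x0 xl].
have [iu iv] : integ 0 x du /\ integ 0 x dv.
  by split; [have := real_L2_integ lu|have := real_L2_integ lv]; apply: integ_sub.
rewrite (ue x) ?(ve x) ?x0// RintD ?RintZ//; try exact: integZ.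
ring.
Qed.

Lemma rH1_0 l : rH1 l (fun=> 0) (fun=> 0).
Proof.
split; first by apply: real_L2_continuous => x; exact: cvg_cst.
by move=> x /andP[x0 _]; rewrite Rint_cst// mul0r addr0.
Qed.

(** The general solution of [f'' = - w ^+ 2 f] for nonzero [w]. Differentiation replaces [(A, B)] by
    [(w B, - w A)], so derivatives stay of the same shape. *)
Definition trig w A B t := A * cos (w * t) + B * sin (w * t).

Lemma is_derive_trig w A B x :
  is_derive x (1 : R) (trig w A B) (trig w (w * B) (- (w * A)) x).
Proof.
have hw : is_derive x (1 : R) (fun t : R => w * t) w.
  by apply: is_derive_eq; rewrite [LHS]mulr1.
have hc : is_derive x (1 : R) (fun t => cos (w * t)) (- sin (w * x) * w).
  exact: (@is_derive1_comp _ (@cos R) (fun t : R => w * t)).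
have hs : is_derive x (1 : R) (fun t => sin (w * t)) (cos (w * x) * w).
  exact: (@is_derive1_comp _ (@sin R) (fun t : R => w * t)).
have h := is_deriveD (is_deriveZ A hc) (is_deriveZ B hs).
apply: (is_derive_eq h); rewrite /trig /GRing.scale /=; ring.
Qed.

Lemma continuous_trig w A B : continuous (trig w A B).
Proof.
move=> x; apply: differentiable_continuous; apply/derivable1_diffP.
by case: (is_derive_trig w A B x).
Qed.

Lemma within_continuous_trig w A B (D : set R) : {within D, continuous (trig w A B)}.
Proof. exact/continuous_subspaceT/continuous_trig. Qed.

Lemma trig_le w A B x : `|trig w A B x| <= `|A| + `|B|.
Proof.
apply: le_trans (ler_normD _ _) _; rewrite !normrM.
by apply: lerD; rewrite -[leRHS]mulr1 ler_wpM2l// ?cos_max ?sin_max.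
Qed.

Lemma rH1_trig l w A B : 0 <= l -> rH1 l (trig w A B) (trig w (w * B) (- (w * A))).
Proof.
move=> l0; split; first exact/real_L2_continuous/within_continuous_trig.
have := primitive_derive l0 (is_derive_trig w A B) (@within_continuous_trig _ _ _ _).
by case.
Qed.

(** Integration by parts against the derivative of a trigonometric solution: the second derivative
    contributes exactly the right-hand side of the weak equation at [w ^+ 2], up to boundary
    terms. *)
Lemma green l u du s w A B : rH1 l u du -> 0 <= s <= l ->
  \int[mu]_(t in `[s, l]) (du t * trig w (w * B) (- (w * A)) t) =
  u l * trig w (w * B) (- (w * A)) l - u s * trig w (w * B) (- (w * A)) s +
  \int[mu]_(t in `[s, l]) (w ^+ 2 * u t * trig w A B t).
Proof.
move=> hu /andP[s0 sl].
have pu := primitive_sub (rH1_primitive hu) s0 sl (lexx l).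
rewrite (primitive_by_parts sl pu (is_derive_trig _ _ _)
   (@continuous_trig _ _ _) (fun x => @trig_le _ _ _ x)).
have iu : integ s l (fun t => u t * trig w (w * - (w * A)) (- (w * (w * B))) t).
  apply: integM_continuous; first exact: within_continuous_trig.
  by apply: integ_continuous; exact: (primitive_continuous sl pu).
congr (_ + _); rewrite -mulN1r -RintZ//.
by apply: eq_Rint => t _; rewrite /trig; ring.
Qed.

(* Truncating to [s, +oo) produces a kink at [s]. *)
Definition kink w s : R -> R := trig w (- sin (w * s)) (cos (w * s)) \_ `[s, +oo[.
Definition dkink w s : R -> R :=
  trig w (w * cos (w * s)) (- (w * - sin (w * s))) \_ `[s, +oo[.

Lemma kinkE w s t : kink w s t = if s <= t then sin (w * (t - s)) else 0.
Proof.
rewrite /kink patchE mem_setE in_itv /= andbT; case: ifP => // _.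
by rewrite /trig mulrBr sinB; ring.
Qed.

Lemma itvI_ge s x : 0 <= s -> `[0, x]%classic `&` `[s, +oo[%classic = `[s, x]%classic :> set R.
Proof.
move=> s0; apply/seteqP; split => t /=; rewrite !in_itv /= andbT.
  by move=> [/andP[_ ->] ->].
by move=> /andP[st tx]; rewrite st tx (le_trans s0).
Qed.

Lemma rH1_kink l w s : 0 <= s <= l -> rH1 l (kink w s) (dkink w s).
Proof.
move=> /andP[s0 sl]; split.
  apply: real_L2_restrict => //.
  exact/real_L2_continuous/within_continuous_trig.
move=> x /andP[x0 xl].
rewrite /dkink -Rintegral_mkcondr itvI_ge// !kinkE.
have -> : (if s <= 0 then sin (w * (0 - s)) else 0) = 0.
  by case: ifP => // s0'; rewrite (_ : s = 0) ?subrr ?mulr0 ?sin0//; apply/eqP; rewrite eq_le s0 s0'.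
rewrite add0r; case: ifP => sx; last first.
  rewrite set_itv_ge ?Rintegral_set0// bnd_simp; exact/negbT.
have := primitive_derive sx (is_derive_trig w (- sin (w * s)) (cos (w * s)))
   (@within_continuous_trig _ _ _ _) => -[_ /(_ x)].
rewrite sx lexx => /(_ isT) e.
move/esym: e; rewrite addrC => /(canRL (addrK _)) ->.
by rewrite /trig [w * (x - s)]mulrBr sinB; ring.
Qed.

(** The derivative of the kink jumps by [w] at [s], so the boundary term there is [- w * u s]:
    testing against a kink evaluates [u] at a point. *)
Lemma green_kink l u du s w : rH1 l u du -> 0 <= s <= l ->
  \int[mu]_(t in `[0, l]) (du t * dkink w s t) =
  w * (u l * cos (w * (l - s)) - u s) +
  \int[mu]_(t in `[0, l]) (w ^+ 2 * u t * kink w s t).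
Proof.
move=> hu /andP[s0 sl].
rewrite (eq_Rint (g := (fun t => du t * trig w (w * cos (w * s)) (- (w * - sin (w * s))) t)
   \_ `[s, +oo[)); last first.
  by move=> t _; rewrite /dkink !patchE; case: ifP => // _; rewrite mulr0.
rewrite [X in _ = _ + X](eq_Rint (g := (fun t => w ^+ 2 * u t * trig w (- sin (w * s)) (cos (w * s)) t)
   \_ `[s, +oo[)); last first.
  by move=> t _; rewrite /kink !patchE; case: ifP => // _; rewrite mulr0.
rewrite -!Rintegral_mkcondr itvI_ge// (green _ _ _ hu) ?s0//.
congr (_ + _); rewrite [w * (l - s)]mulrBr cosB /trig.
have := cos2Dsin2 (w * s) => e.
rewrite (_ : _ - _ = w * (u l * (cos (w * l) * cos (w * s) + sin (w * l) * sin (w * s)))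
  - w * u s * (cos (w * s) ^+ 2 + sin (w * s) ^+ 2)); last by ring.
by rewrite e; ring.
Qed.
End Sobolev.

(** * Weak solutions on a metric graph *)

Section WeakSolutions.
Context {R : realType} (G : metric_graph R) (VD : {set vertex G}).
Local Notation mu := (@lebesgue_measure R).
Local Notation rfun := (edge G -> R -> R).
Local Open Scope complex_scope.
Implicit Types (x y : vertex G -> R) (u du g dg : rfun) (lam w : R).

Definition vanishing y := forall v, v \in VD -> y v = 0.

Definition rH1_dirichlet u du x :=
  [/\ forall e, rH1 (len e) (u e) (du e),
      forall e, u e 0 = x (src e) /\ u e (len e) = x (tgt e)
    & vanishing x].

Definition weak_eq lam u du := forall g dg y, rH1_dirichlet g dg y ->
  \sum_e \int[mu]_(t in `[0, len e]) (du e t * dg e t) =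
  \sum_e \int[mu]_(t in `[0, len e]) (lam * u e t * g e t).

(** The vertex values [x] are kept in the predicate because the later arguments work with this
    finite vector instead of [u]. *)
Definition weak_solution lam u x :=
  exists2 du, rH1_dirichlet u du x & weak_eq lam u du.

Lemma len_ge0 (e : edge G) : 0 <= len e.
Proof. exact/ltW/len_gt0. Qed.

Lemma rH1_dirichlet_comb (a b : R) u v du dv x y :
  rH1_dirichlet u du x -> rH1_dirichlet v dv y ->
  rH1_dirichlet (fun e t => a * u e t + b * v e t)
    (fun e t => a * du e t + b * dv e t) (fun z => a * x z + b * y z).
Proof.
move=> [h1 h2 h3] [k1 k2 k3]; split.
- by move=> e; exact: rH1_comb.
- by move=> e; have [-> ->] := h2 e; have [-> ->] := k2 e.
- by move=> z zD; rewrite h3 ?k3// !mulr0 addr0.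
Qed.

Lemma weak_solution_comb lam (a b : R) u v x y :
  weak_solution lam u x -> weak_solution lam v y ->
  weak_solution lam (fun e t => a * u e t + b * v e t)
    (fun z => a * x z + b * y z).
Proof.
move=> [du hu wu] [dv hv wv]; exists (fun e t => a * du e t + b * dv e t).
  exact: rH1_dirichlet_comb.
move=> g dg z hg.
have [hu1 _ _] := hu; have [hv1 _ _] := hv; have [hg1 _ _] := hg.
have L2u e := (hu1 e).1; have L2v e := (hv1 e).1; have L2g e := (hg1 e).1.
have L2u' e := rH1_L2 (len_ge0 e) (hu1 e).
have L2v' e := rH1_L2 (len_ge0 e) (hv1 e).
have L2g' e := rH1_L2 (len_ge0 e) (hg1 e).
transitivity (a * (\sum_e \int[mu]_(t in `[0, len e]) (du e t * dg e t)) +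
              b * (\sum_e \int[mu]_(t in `[0, len e]) (dv e t * dg e t))).
  rewrite !mulr_sumr -big_split; apply: eq_bigr => e _ /=.
  have i1 := real_L2_mul (L2u e) (L2g e); have i2 := real_L2_mul (L2v e) (L2g e).
  rewrite -!RintZ// -RintD; try exact: integZ.
  by apply: eq_Rint => t _; ring.
rewrite (wu _ _ _ hg) (wv _ _ _ hg).
rewrite !mulr_sumr -big_split; apply: eq_bigr => e _ /=.
have i1 : integ 0 (len e) (fun t => lam * u e t * g e t).
  have := integZ lam (real_L2_mul (L2u' e) (L2g' e)).
  by apply: eq_integrable => // t _ /=; rewrite mulrA.
have i2 : integ 0 (len e) (fun t => lam * v e t * g e t).
  have := integZ lam (real_L2_mul (L2v' e) (L2g' e)).
  by apply: eq_integrable => // t _ /=; rewrite mulrA.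
rewrite -!RintZ// -RintD; try exact: integZ.
by apply: eq_Rint => t _; ring.
Qed.

(** Test functions supported on one edge localize the weak equation to that edge. *)
Lemma rH1_dirichlet_edge (e : edge G) (g dg : R -> R) :
  rH1 (len e) g dg -> g 0 = 0 -> g (len e) = 0 ->
  rH1_dirichlet (fun e' t => if e' == e then g t else 0)
    (fun e' t => if e' == e then dg t else 0) (fun=> 0).
Proof.
move=> hg g0 gl; split => //.
- by move=> e'; have [->|_] := eqVneq e' e => //; exact: rH1_0.
- by move=> e'; have [->|_] := eqVneq e' e.
Qed.

Lemma weak_eq_edge lam u du (e : edge G) (g dg : R -> R) : weak_eq lam u du ->
  rH1 (len e) g dg -> g 0 = 0 -> g (len e) = 0 ->
  \int[mu]_(t in `[0, len e]) (du e t * dg t) =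
  \int[mu]_(t in `[0, len e]) (lam * u e t * g t).
Proof.
move=> wu hg g0 gl; have := wu _ _ _ (rH1_dirichlet_edge hg g0 gl).
rewrite (bigD1 e) //= big1 ?addr0; last first.
  move=> e' /negbTE ne; rewrite ne.
  by rewrite (eq_Rint (g := fun=> 0)) ?Rint_cst ?mul0r ?len_ge0// => t _; rewrite mulr0.
rewrite [RHS](bigD1 e) //= [X in _ + X]big1 ?addr0; last first.
  move=> e' /negbTE ne; rewrite ne.
  by rewrite (eq_Rint (g := fun=> 0)) ?Rint_cst ?mul0r ?len_ge0// => t _; rewrite mulr0.
by rewrite eqxx.
Qed.

(* Test against the combination of the kinks at [p] and [q] that vanishes at
   the far end of [e]. *)
Lemma weak_solution_kink w u x (e : edge G) (p q : R) :
  0 < w -> weak_solution (w ^+ 2) u x ->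
  0 <= p <= len e -> 0 <= q <= len e ->
  sin (w * (len e - q)) * (u e (len e) * cos (w * (len e - p)) - u e p) =
  sin (w * (len e - p)) * (u e (len e) * cos (w * (len e - q)) - u e q).
Proof.
move=> w0 [du [hu _ _] wu] pl ql; set l := len e.
set a := sin (w * (l - q)); set b := sin (w * (l - p)).
have hg := rH1_comb a (- b) (rH1_kink w pl) (rH1_kink w ql).
have k0 s : 0 <= s <= len e -> kink w s 0 = 0.
  move=> /andP[s0 _]; rewrite kinkE; case: ifP => // s0'.
  by rewrite (_ : s = 0) ?subrr ?mulr0 ?sin0//; apply/eqP; rewrite eq_le s0 s0'.
have kl s : 0 <= s <= len e -> kink w s l = sin (w * (l - s)).
  by move=> /andP[_ sl]; rewrite kinkE sl.
have := weak_eq_edge wu hg.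
rewrite !k0// !mulr0 addr0 !kl// -/a -/b => /(_ erefl); rewrite mulNr mulrC subrr.
move=> /(_ erefl).
have L2u := rH1_L2 (len_ge0 e) (hu e).
have L2k s (sl : 0 <= s <= len e) := rH1_L2 (len_ge0 e) (rH1_kink w sl).
have i1 s : 0 <= s <= len e -> integ 0 l (fun t => du e t * dkink w s t).
  by move=> sl; exact: real_L2_mul (hu e).1 (rH1_kink w sl).1.
have i2 s : 0 <= s <= len e -> integ 0 l (fun t => w ^+ 2 * u e t * kink w s t).
  move=> sl; have := integZ (w ^+ 2) (real_L2_mul L2u (L2k _ sl)).
  by apply: eq_integrable => // t _ /=; rewrite mulrA.
rewrite (eq_Rint (g := fun t => a * (du e t * dkink w p t) +
   (- b) * (du e t * dkink w q t))); last by move=> t _; ring.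
rewrite [RHS](eq_Rint (g := fun t => a * (w ^+ 2 * u e t * kink w p t) +
   (- b) * (w ^+ 2 * u e t * kink w q t))); last by move=> t _; ring.
rewrite RintD ?RintZ; try by [exact: i1|apply: integZ; exact: i1].
rewrite [RHS]RintD ?RintZ; try by [exact: i2|apply: integZ; exact: i2].
rewrite !(green_kink _ (hu e))// -/l => h.
apply: (mulfI (lt0r_neq0 w0)).
by move: h; set I1 := Rintegral _ _ _; set I2 := Rintegral _ _ _ => h; lra.
Qed.

(** With one reference point [q] such that [sin (w * (len e - q))] is nonzero, the kink relation
    solves for [u] at every other point, and the addition formulas put the result in trigonometric
    form. *)
Lemma weak_solution_trig w u x (e : edge G) : 0 < w -> weak_solution (w ^+ 2) u x ->
  exists A B, forall t, 0 <= t <= len e -> u e t = trig w A B t.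
Proof.
move=> w0 hu; set l := len e; have l0 : 0 < l by exact: len_gt0.
have p0 := @pi_gt0 R.
(* The reference point is [l - c]; this choice gives [0 < w * c <= pi / 2], hence a positive
   sine. *)
pose c := Num.min l (pi / 2 / w).
have c0 : 0 < c by rewrite lt_min l0 !divr_gt0.
have s0 : 0 < sin (w * c).
  apply: sin_gt0_pi; rewrite mulr_gt0//=.
  have : w * c <= pi / 2 by rewrite mulrC -ler_pdivlMr// ge_min lexx orbT.
  by move/le_lt_trans; apply; lra.
have cl : c <= l by rewrite ge_min lexx.
pose K := (u e l * cos (w * c) - u e (l - c)) / sin (w * c).
exists (u e l * cos (w * l) - K * sin (w * l)),
       (u e l * sin (w * l) + K * cos (w * l)) => t tl.
have ql : 0 <= l - c <= l by apply/andP; split; lra.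
have := weak_solution_kink w0 hu tl ql; rewrite -/l (_ : l - (l - c) = c); last by ring.
move=> h; have -> : u e t = u e l * cos (w * (l - t)) - K * sin (w * (l - t)).
  apply: (mulfI (lt0r_neq0 s0)); rewrite mulrBr.
  have -> : sin (w * c) * (K * sin (w * (l - t))) =
     sin (w * (l - t)) * (u e l * cos (w * c) - u e (l - c)).
    by rewrite /K; field; rewrite gt_eqF.
  by rewrite -h; ring.
by rewrite /trig mulrBr cosB sinB; ring.
Qed.

(** The trigonometric solution with values [a] at 0 and [b] at [l], provided that [sin (w * l)] is
    nonzero. *)
Definition profile w (l a b : R) : R -> R :=
  trig w a ((b - a * cos (w * l)) / sin (w * l)).

Lemma profile0 w l a b : profile w l a b 0 = a.
Proof. by rewrite /profile /trig mulr0 cos0 sin0; ring. Qed.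

Lemma profile_end w l a b : sin (w * l) != 0 -> profile w l a b l = b.
Proof. by move=> s0; rewrite /profile /trig; field. Qed.

(** The Dirichlet-to-Neumann form: the value of [int u' v' - w ^+ 2 * int u v] when [u] and [v] are
    the edgewise profiles with vertex values [x] and [y]. *)
Definition dtn_form w x y : R := \sum_(e : edge G)
  w * ((x (src e) * y (src e) + x (tgt e) * y (tgt e)) * cos (w * len e)
       - (x (src e) * y (tgt e) + x (tgt e) * y (src e))) / sin (w * len e).

Lemma rH1_dirichlet_profile w y : (forall e : edge G, sin (w * len e) != 0) ->
  vanishing y ->
  rH1_dirichlet (fun e => profile w (len e) (y (src e)) (y (tgt e)))
    (fun e => trig w (w * ((y (tgt e) - y (src e) * cos (w * len e)) / sin (w * len e)))
       (- (w * y (src e)))) y.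
Proof.
move=> s0 hy; split => //.
- by move=> e; apply: rH1_trig; exact: len_ge0.
- by move=> e; rewrite profile0 profile_end.
Qed.

(** Testing against the profiles with vertex values [y], Green's identity leaves only boundary
    terms, and these add up to [dtn_form w x y]. *)
Lemma weak_solution_profile w u x : 0 < w -> (forall e : edge G, sin (w * len e) != 0) ->
  weak_solution (w ^+ 2) u x ->
  (forall e t, 0 <= t <= len e ->
     u e t = profile w (len e) (x (src e)) (x (tgt e)) t) /\
  (forall y, vanishing y -> dtn_form w x y = 0).
Proof.
move=> w0 s0 hu; split.
  move=> e t tl; have [A [B h]] := weak_solution_trig e w0 hu.
  have l0 := len_ge0 e.
  have [du [_ /(_ e) [h1 h2] _] _] := hu.
  have eA : A = x (src e) by rewrite -h1 h ?lexx// /trig mulr0 cos0 sin0; ring.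
  have eB : B = (x (tgt e) - x (src e) * cos (w * len e)) / sin (w * len e).
    by rewrite -h2 h ?lexx ?l0// /trig eA; field; exact: s0.
  by rewrite h// eA eB.
move=> y hy; have [du hu1 wu] := hu; have [r1 r2 _] := hu1.
have hg := rH1_dirichlet_profile s0 hy.
have := wu _ _ _ hg.
rewrite (eq_bigr (fun e => w * ((x (src e) * y (src e) + x (tgt e) * y (tgt e)) * cos (w * len e)
       - (x (src e) * y (tgt e) + x (tgt e) * y (src e))) / sin (w * len e) +
   \int[mu]_(t in `[0, len e]) (w ^+ 2 * u e t *
     profile w (len e) (y (src e)) (y (tgt e)) t))); last first.
  move=> e _; rewrite (green _ _ _ (r1 e)) ?lexx ?len_ge0//; congr (_ + _).
  have [-> ->] := r2 e; rewrite /trig mulr0 cos0 sin0.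
  have := cos2Dsin2 (w * len e) => e2.
  apply: (mulIf (s0 e)); rewrite mulfVK//.
  transitivity (w * (x (tgt e) * y (tgt e) * cos (w * len e) - x (tgt e) * y (src e) *
     (cos (w * len e) ^+ 2 + sin (w * len e) ^+ 2)
     - x (src e) * (y (tgt e) - y (src e) * cos (w * len e)))).
    by field; exact: s0.
  by rewrite e2; ring.
by rewrite big_split /= -[RHS]add0r => /addIr.
Qed.

Lemma trig_weak_solution w (A B : edge G -> R) x : vanishing x ->
  (forall e, A e = x (src e)) ->
  (forall e, trig w (A e) (B e) (len e) = x (tgt e)) ->
  (forall y, vanishing y -> \sum_e (y (tgt e) * trig w (w * B e) (- (w * A e)) (len e)
     - y (src e) * (w * B e)) = 0) ->
  weak_solution (w ^+ 2) (fun e => trig w (A e) (B e)) x.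
Proof.
move=> hx h0 hl hy; exists (fun e => trig w (w * B e) (- (w * A e))).
  split => //.
    by move=> e; apply: rH1_trig; exact: len_ge0.
  by move=> e; rewrite hl -h0 /trig mulr0 cos0 sin0; split => //; ring.
move=> g dg y [r1 r2 r3].
rewrite (eq_bigr (fun e => (y (tgt e) * trig w (w * B e) (- (w * A e)) (len e)
     - y (src e) * (w * B e)) +
   \int[mu]_(t in `[0, len e]) (w ^+ 2 * trig w (A e) (B e) t * g e t))); last first.
  move=> e _; rewrite (eq_Rint (g := fun t => dg e t * trig w (w * B e) (- (w * A e)) t)).
    rewrite (green _ _ _ (r1 e)) ?lexx ?len_ge0//; have [-> ->] := r2 e; congr (_ - _ + _).
      by rewrite /trig mulr0 cos0 sin0; ring.
    by apply: eq_Rint => t _; ring.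
  by move=> t _; rewrite mulrC.
by rewrite big_split /= hy// add0r.
Qed.

Lemma profile_weak_solution w x : (forall e : edge G, sin (w * len e) != 0) ->
  vanishing x -> (forall y, vanishing y -> dtn_form w x y = 0) ->
  weak_solution (w ^+ 2)
    (fun e => profile w (len e) (x (src e)) (x (tgt e))) x.
Proof.
move=> s0 hx hy; apply: trig_weak_solution => //.
- by move=> e; exact: profile_end.
- move=> y yD; rewrite -[RHS](hy y yD); apply: eq_bigr => e _.
  have := cos2Dsin2 (w * len e) => e2.
  apply: (mulIf (s0 e)); rewrite mulfVK// /trig.
  transitivity (w * (y (tgt e) * (x (tgt e) * cos (w * len e) - x (src e) *
     (cos (w * len e) ^+ 2 + sin (w * len e) ^+ 2)) -
     y (src e) * (x (tgt e) - x (src e) * cos (w * len e)))).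
    by field; exact: s0.
  by rewrite e2; ring.
Qed.

Lemma connected_cst (T : Type) (x : vertex G -> T) :
  (forall e, x (tgt e) = x (src e)) -> forall v v', x v = x v'.
Proof.
move=> xe v v'; have /connectP[p pp ->{v'}] := graph_connected v v'.
elim: p v pp => //= v' p IH v /andP[vv' pp]; rewrite -(IH v' pp).
by move: vv' => /existsP[e /orP[]] /andP[/eqP <- /eqP <-]; rewrite xe.
Qed.

(** Testing [u] against itself shows that [u'] has zero L2 norm. So [u] is constant on every edge,
    hence on the connected graph, and it vanishes at [v0]. *)
Lemma weak_solution_le0 lam u x v0 : v0 \in VD -> lam <= 0 ->
  weak_solution lam u x -> forall e t, 0 <= t <= len e -> u e t = 0.
Proof.
move=> v0D lam0 [du hu wu]; have [r1 r2 r3] := hu.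
have E := wu _ _ _ hu.
have sq0 e : 0 <= \int[mu]_(t in `[0, len e]) (du e t * du e t).
  by apply: Rintegral_ge0 => t _; rewrite -expr2 sqr_ge0.
have sum0 : \sum_e \int[mu]_(t in `[0, len e]) (du e t * du e t) = 0.
  apply/eqP; rewrite eq_le sumr_ge0 ?andbT; last by move=> *; exact: sq0.
  rewrite E; apply: sumr_le0 => e _.
  have L2u := rH1_L2 (len_ge0 e) (r1 e).
  rewrite (eq_Rint (g := fun t => lam * (u e t * u e t))); last by move=> t _; ring.
  rewrite RintZ; last exact: real_L2_mul.
  by apply: mulr_le0_ge0 => //; apply: Rintegral_ge0 => t _; rewrite -expr2 sqr_ge0.
have sqe e : \int[mu]_(t in `[0, len e]) (du e t * du e t) = 0.
  by move/eqP : sum0; rewrite psumr_eq0 => [/allP/(_ e)|*]; [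
    rewrite mem_index_enum => /(_ isT)/eqP|exact: sq0].
(* The pointwise bound [|du| <= d^-1 * du ^+ 2 + d] with [d = eps / len e] has integral [eps], since
   the square integrates to 0. *)
have I0 e t : 0 <= t <= len e -> \int[mu]_(s in `[0, t]) du e s = 0.
  move=> /andP[t0 tl]; apply/eqP; rewrite -normr_le0; apply/ler_addgt0Pl => eps eps0.
  have L2d := (r1 e).1; have l0 := len_gt0 e.
  pose d := eps / len e.
  have d0 : 0 < d by exact: divr_gt0.
  have i1 : integ 0 (len e) (fun s => d^-1 * (du e s * du e s) + d).
    by apply: integD; [apply: integZ; exact: real_L2_mul|exact: integ_cst].
  have i2 : integ 0 (len e) (du e) by exact: real_L2_integ.
  apply: le_trans (le_norm_Rint (g := fun s => d^-1 * (du e s * du e s) + d) _ _ _) _.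
  - exact: integ_sub i2.
  - exact: integ_sub i1.
  - move=> s _; rewrite -(ler_pM2l d0) mulrDr mulVKf ?gt_eqF//.
    by rewrite -expr2 -real_normK ?num_real//; have := normr_ge0 (du e s); nra.
  - rewrite addr0.
    have -> : eps = \int[mu]_(s in `[0, len e]) (d^-1 * (du e s * du e s) + d).
      rewrite RintD; [|by apply: integZ; exact: real_L2_mul|exact: integ_cst].
      rewrite RintZ; last exact: real_L2_mul.
      by rewrite sqe Rint_cst ?len_ge0// /d; field; rewrite !gt_eqF.
    rewrite [leRHS](@Rint_split _ 0 (len e) _ t) ?t0//.
    rewrite lerDl; apply: Rintegral_ge0 => s _.
    by rewrite addr_ge0 ?(ltW d0)// mulr_ge0 ?invr_ge0 ?(ltW d0)// -expr2 sqr_ge0.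
have cst e t : 0 <= t <= len e -> u e t = u e 0.
  by move=> tl; rewrite (r1 e).2// I0// addr0.
have xe e : x (tgt e) = x (src e).
  by have [<- <-] := r2 e; rewrite cst// lexx len_ge0.
by move=> e t tl; rewrite cst//; have [-> _] := r2 e; rewrite (connected_cst xe _ v0) r3.
Qed.

(** * Passage between complex eigenfunctions and real weak solutions *)

Local Notation Re := complex.Re.
Local Notation Im := complex.Im.

Lemma Re_mul_conj (a b : R[i]) : Re (a * b^*) = Re a * Re b + Im a * Im b.
Proof. by case: a => ? ?; case: b => ? ? /=; ring. Qed.

Lemma Im_mul_conj (a b : R[i]) : Im (a * b^*) = Im a * Re b - Re a * Im b.
Proof. by case: a => ? ?; case: b => ? ? /=; ring. Qed.

Lemma Re_mulC (a : R) (b : R[i]) : Re (a%:C * b) = a * Re b.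
Proof. by case: b => ? ? /=; ring. Qed.

Lemma Im_mulC (a : R) (b : R[i]) : Im (a%:C * b) = a * Im b.
Proof. by case: b => ? ? /=; ring. Qed.

Lemma complex_ext (a b : R[i]) : Re a = Re b -> Im a = Im b -> a = b.
Proof. by case: a => ? ?; case: b => ? ? /= -> ->. Qed.

Lemma H1_derivP (l : R) (f df : R -> R[i]) : H1_deriv l f df <->
  rH1 l (fun t => Re (f t)) (fun t => Re (df t)) /\
  rH1 l (fun t => Im (f t)) (fun t => Im (df t)).
Proof.
split.
  move=> [[l1 l2] h]; split; split => // t /h ->; by case: (f 0).
move=> [[l1 h1] [l2 h2]]; split => // t tl; apply: complex_ext.
  by rewrite h1//; case: (f 0).
by rewrite h2//; case: (f 0).
Qed.

Lemma Re_graph_inner (f g : graph_fun G) : Re (graph_inner f g) =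
  \sum_e \int[mu]_(t in `[0, len e]) (Re (f e t * (g e t)^*)).
Proof. by rewrite /graph_inner; elim/big_rec2: _ => //= e a [b c] _ /= ->. Qed.

Lemma Im_graph_inner (f g : graph_fun G) : Im (graph_inner f g) =
  \sum_e \int[mu]_(t in `[0, len e]) (Im (f e t * (g e t)^*)).
Proof. by rewrite /graph_inner; elim/big_rec2: _ => //= e a [b c] _ /= ->. Qed.

(** As [lam] is real, testing against real functions separates the equation into its real and
    imaginary parts. *)
Lemma laplacian_weak_solution lam (f : graph_fun G) :
  laplacian VD f (fun e t => lam%:C * f e t) ->
  (exists x, weak_solution lam (fun e t => Re (f e t)) x) /\
  (exists x, weak_solution lam (fun e t => Im (f e t)) x).
Proof.
move=> [_ [df [hf [phi fphi phiD]] wf]].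
have test g dg y : rH1_dirichlet g dg y ->
    H1_dirichlet VD (fun e t => (g e t)%:C) (fun e t => (dg e t)%:C).
  move=> [r1 r2 r3]; split.
    by move=> e; apply/H1_derivP; split; [exact: r1|exact: rH1_0].
  exists (fun v => (y v)%:C); first by move=> e; have [-> ->] := r2 e.
  by move=> v /r3 ->.
split.
  exists (fun v => Re (phi v)); exists (fun e t => Re (df e t)).
    split.
    - by move=> e; have /H1_derivP[] := hf e.
    - by move=> e; have [-> ->] := fphi e.
    - by move=> v /phiD ->.
  move=> g dg y /test/wf/(congr1 (@complex.Re R)); rewrite !Re_graph_inner => E.
  rewrite (eq_bigr (fun e => \int[mu]_(t in `[0, len e]) (Re (df e t * ((dg e t)%:C)^*)))).
    rewrite E; apply: eq_bigr => e _; apply: eq_Rint => t _.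
    by rewrite Re_mul_conj Re_mulC/= mulr0 addr0.
  by move=> e _; apply: eq_Rint => t _; rewrite Re_mul_conj/= mulr0 addr0.
exists (fun v => Im (phi v)); exists (fun e t => Im (df e t)).
  split.
  - by move=> e; have /H1_derivP[] := hf e.
  - by move=> e; have [-> ->] := fphi e.
  - by move=> v /phiD ->.
move=> g dg y /test/wf/(congr1 (@complex.Im R)); rewrite !Im_graph_inner => E.
rewrite (eq_bigr (fun e => \int[mu]_(t in `[0, len e]) (Im (df e t * ((dg e t)%:C)^*)))).
  rewrite E; apply: eq_bigr => e _; apply: eq_Rint => t _.
  by rewrite Im_mul_conj Im_mulC/= mulr0 subr0.
by move=> e _; apply: eq_Rint => t _; rewrite Im_mul_conj/= mulr0 subr0.
Qed.

(** The real and imaginary parts of a complex test function are admissible real test functions, and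
    each gives one component of the identity. *)
Lemma weak_solution_laplacian lam u x : weak_solution lam u x ->
  laplacian VD (fun e t => (u e t)%:C) (fun e t => lam%:C * (u e t)%:C).
Proof.
move=> [du hu wu]; have [r1 r2 r3] := hu.
split.
  move=> e; have L := rH1_L2 (len_ge0 e) (r1 e); split => /=.
    by apply: eq_real_L2 (real_L2_comb lam 0 L L) => t; ring.
  by apply: eq_real_L2 (real_L2_comb 0 0 L L) => t; ring.
exists (fun e t => (du e t)%:C).
  split; first by move=> e; apply/H1_derivP; split; [exact: r1|exact: rH1_0].
  exists (fun v => (x v)%:C); first by move=> e; have [-> ->] := r2 e.
  by move=> v /r3 ->.
move=> g dg [hg [phi gphi phiD]].
have tRe : rH1_dirichlet (fun e t => Re (g e t)) (fun e t => Re (dg e t)) (fun v => Re (phi v)).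
  split.
  - by move=> e; have /H1_derivP[] := hg e.
  - by move=> e; have [-> ->] := gphi e.
  - by move=> v /phiD ->.
have tIm : rH1_dirichlet (fun e t => Im (g e t)) (fun e t => Im (dg e t)) (fun v => Im (phi v)).
  split.
  - by move=> e; have /H1_derivP[] := hg e.
  - by move=> e; have [-> ->] := gphi e.
  - by move=> v /phiD ->.
apply: complex_ext.
  rewrite !Re_graph_inner; transitivity (\sum_e \int[mu]_(t in `[0, len e]) (du e t * Re (dg e t))).
    by apply: eq_bigr => e _; apply: eq_Rint => t _; rewrite Re_mul_conj /= mul0r addr0.
  rewrite (wu _ _ _ tRe).
  apply: eq_bigr => e _; apply: eq_Rint => t _.
  by rewrite Re_mul_conj Re_mulC Im_mulC /=; ring.
(* Conjugation reverses the imaginary part, so the second test function is [- Im g]. *)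
have tN := rH1_dirichlet_comb (-1) 0 tIm tIm.
rewrite !Im_graph_inner.
transitivity (\sum_e \int[mu]_(t in `[0, len e]) (du e t * (-1 * Im (dg e t) + 0 * Im (dg e t)))).
  by apply: eq_bigr => e _; apply: eq_Rint => t _; rewrite Im_mul_conj /=; ring.
rewrite (wu _ _ _ tN).
apply: eq_bigr => e _; apply: eq_Rint => t _.
by rewrite Im_mul_conj Re_mulC Im_mulC /=; ring.
Qed.

End WeakSolutions.

(** * The Dirichlet-to-Neumann form *)

Section DtnForm.
Context {R : realType}.

Lemma cvg_sumr (I T : Type) (F : set_system T) {FF : Filter F} (r : seq I)
    (f : I -> T -> R) (a : I -> R) :
  (forall i, f i x @[x --> F] --> a i) ->
  \sum_(i <- r) f i x @[x --> F] --> \sum_(i <- r) a i.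
Proof.
move=> h; elim: r => [|i r IH].
  by rewrite big_nil; under eq_cvg do rewrite big_nil; exact: cvg_cst.
by rewrite big_cons; under eq_cvg do rewrite big_cons; exact: cvgD.
Qed.

Implicit Types (l w t : R).

(* The continuous extension of [sin (w * l) / w]. *)
Definition sinc l w : R := if w == 0 then l else sin (w * l) / w.

(** At 0, [sin (w * l) / w] is the difference quotient of [sin (l * t)], whose derivative at 0 is
    [l]. *)
Lemma continuous_sinc l : continuous (sinc l).
Proof.
move=> w; have [->|w0] := eqVneq w 0.
  apply/continuous_withinNx; rewrite {2}/sinc eqxx.
  have [dd dv] := is_derive_trig l 0 1 0.
  have cv : h^-1 *: ((trig l 0 1 \o shift 0) (h *: (1 : R)) - trig l 0 1 0)
      @[h --> (0 : R)^'] --> l.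
    move: dv; rewrite /derive => dv.
    by apply: cvg_toP => //; rewrite dv /trig mulr0 cos0 sin0; ring.
  apply: cvg_trans cv; apply: near_eq_cvg; near=> h.
  have h0 : h != 0 by near: h; exact: nbhs_dnbhs_neq.
  rewrite /sinc (negbTE h0) /trig /= mulr0 sin0 addr0 [_ *: 1]mulr1 [_ *: _]mulrC.
  by rewrite (mulrC l); ring.
have : {for w, continuous (fun w => sin (w * l) / w)}.
  apply: cvgM; last exact: cvgV.
  apply: continuous_comp; last exact: continuous_sin.
  by apply: cvgM; [exact: cvg_id|exact: cvg_cst].
move=> cw; rewrite /continuous_at [sinc l w]/sinc (negbTE w0).
apply: cvg_trans cw; apply: near_eq_cvg.
near=> h; rewrite /sinc ifF//; apply/negbTE.
by near: h; have := @open_neq R 0; rewrite openE => /(_ w w0).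
Unshelve. all: by end_near. Qed.

Lemma sinc_gt0 l w : 0 < l -> 0 <= w -> w * l < pi -> 0 < sinc l w.
Proof.
move=> l0; rewrite le_eqVlt /sinc => /predU1P[<-|w0 wl]; first by rewrite eqxx.
by rewrite gt_eqF// divr_gt0// sin_gt0_pi// mulr_gt0.
Qed.

Lemma quadratic_ge0 (b c : R) : (forall t, 0 <= 2 * t * b + t ^+ 2 * c) -> b = 0.
Proof.
(* At this point the quadratic equals [- b ^+ 2 * (2 * (|c| + 1) - c) / (|c| + 1) ^+ 2], which is
   negative unless [b = 0]. *)
move=> h; have h1 := h (- b / (`|c| + 1)).
have c1 : 0 < `|c| + 1 by rewrite ltr_pwDr.
have : 0 <= (2 * (- b / (`|c| + 1)) * b + (- b / (`|c| + 1)) ^+ 2 * c) * (`|c| + 1) ^+ 2.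
  by apply: mulr_ge0 => //; apply: sqr_ge0.
have -> : (2 * (- b / (`|c| + 1)) * b + (- b / (`|c| + 1)) ^+ 2 * c) * (`|c| + 1) ^+ 2 =
   - b ^+ 2 * (2 * (`|c| + 1) - c) by field; rewrite gt_eqF.
have := ler_norm c => cn b2.
have : b ^+ 2 <= 0.
  rewrite -oppr_ge0 -(pmulr_lge0 (x := 2 * (`|c| + 1) - c))//; lra.
by rewrite le_eqVlt sqrf_eq0 ltNge sqr_ge0 orbF => /eqP.
Qed.

Context (G : metric_graph R) (VD : {set vertex G}).
Implicit Types (x y : vertex G -> R).
Local Notation vanishing := (vanishing VD).

Lemma dtn_formD w x y t : dtn_form w (fun v => x v + t * y v) (fun v => x v + t * y v) =
  dtn_form w x x + (2 * t * dtn_form w x y + t ^+ 2 * dtn_form w y y).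
Proof.
rewrite /dtn_form !mulr_sumr -!big_split; apply: eq_bigr => e _ /=; ring.
Qed.

Lemma dtn_formZ w x t :
  dtn_form w (fun v => t * x v) (fun v => t * x v) = t ^+ 2 * dtn_form w x x.
Proof. rewrite /dtn_form !mulr_sumr; apply: eq_bigr => e _ /=; ring. Qed.

(** Absolute values preserve the diagonal terms, and the off-diagonal coefficient
    [- w / sin (w * len e)] is negative below [pi]. *)
Lemma dtn_form_norm w x : 0 < w -> (forall e : edge G, w * len e < pi) ->
  dtn_form w (fun v => `|x v|) (fun v => `|x v|) <= dtn_form w x x.
Proof.
move=> w0 wl; apply: ler_sum => e _; apply: ler_wpM2r.
  by rewrite invr_ge0 ltW// sin_gt0_pi// wl mulr_gt0// len_gt0.
apply: ler_wpM2l; first exact: ltW.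
have n2 (a : R) : `|a| * `|a| = a * a by rewrite -normrM ger0_norm// -expr2 sqr_ge0.
rewrite !n2; apply: lerB => //.
by have := ler_norm (x (src e) * x (tgt e)); rewrite normrM; lra.
Qed.

(** An isotropic vector of a positive semidefinite form lies in its kernel: the value at [x + t y]
    is nonnegative for every [t], so its linear coefficient vanishes. *)
Lemma dtn_form_kernel w x : vanishing x ->
  (forall y, vanishing y -> 0 <= dtn_form w y y) -> dtn_form w x x <= 0 ->
  forall y, vanishing y -> dtn_form w x y = 0.
Proof.
move=> hx psd xle0 y hy; have x0 : dtn_form w x x = 0 by apply/eqP; rewrite eq_le xle0 psd.
apply: (@quadratic_ge0 _ (dtn_form w y y)) => t.
have := psd (fun v => x v + t * y v); rewrite dtn_formD x0 add0r; apply => v vD.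
by rewrite hx ?hy// mulr0 addr0.
Qed.

(** Every summand is continuous in the frequency as long as the sines do not vanish, so the
    inequality passes to the limit from the left. *)
Lemma dtn_form_limit w y : 0 < w -> (forall e : edge G, w * len e < pi) ->
  (forall w', 0 < w' < w -> 0 <= dtn_form w' y y) -> 0 <= dtn_form w y y.
Proof.
move=> w0 wl h.
have cv : dtn_form w' y y @[w' --> w] --> dtn_form w y y.
  apply: cvg_sumr => e.
  have cw : w' * len e @[w' --> w] --> w * len e.
    by apply: cvgM; [exact: cvg_id|exact: cvg_cst].
  apply: cvgM; last first.
    apply: cvgV; first by rewrite gt_eqF// sin_gt0_pi// wl mulr_gt0// len_gt0.
    by apply: (cvg_comp _ _ cw); exact: continuous_sin.
  apply: cvgM; first exact: cvg_id.
  apply: cvgB; last exact: cvg_cst.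
  apply: cvgM; first exact: cvg_cst.
  by apply: (cvg_comp _ _ cw); exact: continuous_cos.
apply: (cvgr_to_ge (F := w^'-)); first exact: cvg_at_left_filter cv.
by near=> w'; apply: h; apply/andP; split.
Unshelve. all: by end_near. Qed.

Lemma vertex_fun_eq0 x : ~ (exists v, x v != 0) -> forall v, x v = 0.
Proof. by move=> h v; apply/eqP/negPn/negP => xv; apply: h; exists v. Qed.

Let n := #|vertex G|.
Let vertex_fun (X : 'rV[R]_n) : vertex G -> R := fun v => X ord0 (enum_rank v).

(* [dtn_form w x x], extended to all [w] and continuous. *)
Let clamped_form (w2 : R) (p : R * 'rV[R]_n) : R := \sum_(e : edge G)
  (sinc (len e) (Num.max 0 (Num.min p.1 w2)))^-1 *
  ((vertex_fun p.2 (src e) ^+ 2 + vertex_fun p.2 (tgt e) ^+ 2) * cos (p.1 * len e) -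
   2 * vertex_fun p.2 (src e) * vertex_fun p.2 (tgt e)).

Lemma continuous_vertex_fun v : continuous (fun p : R * 'rV[R]_n => vertex_fun p.2 v).
Proof.
move=> p; apply: (@continuous_comp _ _ _ snd (fun X : 'rV[R]_n => vertex_fun X v)).
  exact: cvg_snd.
exact: coord_continuous.
Qed.

(** Clamping the frequency to [[0, w2]] inside [sinc] keeps all denominators positive; the value at
    frequency 0 is the limit [1 / len e] of [w / sin (w * len e)]. *)
Lemma continuous_clamped_form w2 : 0 <= w2 -> (forall e : edge G, w2 * len e < pi) ->
  continuous (clamped_form w2).
Proof.
move=> w20 w2l p; apply: cvg_sumr => e; have cf v := @continuous_vertex_fun v p.
have c1 : q.1 @[q --> p] --> p.1 by exact: cvg_fst.
apply: cvgM.
  apply: cvgV.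
    rewrite gt_eqF// sinc_gt0 ?len_gt0// ?le_max ?lexx//.
    have : Num.max 0 (Num.min p.1 w2) <= w2 by rewrite ge_max w20 ge_min lexx orbT.
    by move=> /(ler_wpM2r (len_ge0 e))/le_lt_trans; apply.
  have cm : Num.min q.1 w2 @[q --> p] --> Num.min p.1 w2.
    exact: (@continuous_min _ _ (fun q : R * 'rV[R]_n => q.1) (fun=> w2) p c1 (cvg_cst _)).
  have cc : Num.max 0 (Num.min q.1 w2) @[q --> p] --> Num.max 0 (Num.min p.1 w2).
    exact: (@continuous_max _ _ (fun=> 0) (fun q : R * 'rV[R]_n => Num.min q.1 w2) p (cvg_cst _) cm).
  by apply: (cvg_comp _ _ cc); exact: continuous_sinc.
apply: cvgB.
  apply: cvgM; first by apply: cvgD; apply: cvgM; exact: cf.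
  have cl : q.1 * len e @[q --> p] --> p.1 * len e by apply: cvgM => //; exact: cvg_cst.
  by apply: (cvg_comp _ _ cl); exact: continuous_cos.
apply: cvgM; last exact: cf.
by apply: cvgM; [exact: cvg_cst|exact: cf].
Qed.

Lemma clamped_formE w2 w X : 0 < w <= w2 ->
  clamped_form w2 (w, X) = dtn_form w (vertex_fun X) (vertex_fun X).
Proof.
move=> /andP[w0 ww]; apply: eq_bigr => e _ /=.
rewrite min_l// max_r ?(ltW w0)// /sinc gt_eqF// invf_div; ring.
Qed.

Let vertex_row x : 'rV[R]_n := \row_i x (enum_val i).
Lemma vertex_fun_row x : vertex_fun (vertex_row x) = x.
Proof. by apply/funext => v; rewrite /vertex_fun mxE enum_rankK. Qed.

Let sumsq x := \sum_v x v ^+ 2.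

Lemma unit_sphere_scaling x : vanishing x -> (exists v, x v != 0) ->
  exists c, [/\ c != 0, vanishing (fun v => c * x v),
                sumsq (fun v => c * x v) = 1 & forall v, `|c * x v| <= 1].
Proof.
move=> hx [v xv].
have s0 : 0 < sumsq x.
  rewrite /sumsq (bigD1 v)//= ltr_pwDl//; first by rewrite lt0r sqrf_eq0 xv sqr_ge0.
  by apply: sumr_ge0 => *; exact: sqr_ge0.
have sq0 : 0 < Num.sqrt (sumsq x) by rewrite sqrtr_gt0.
have c0 : (Num.sqrt (sumsq x))^-1 != 0 by rewrite invr_eq0 gt_eqF.
have : sumsq (fun v => (Num.sqrt (sumsq x))^-1 * x v) = 1.
  rewrite /sumsq; under eq_bigr do rewrite exprMn.
  by rewrite -mulr_sumr exprVn sqr_sqrtr ?(ltW s0)// mulVf// gt_eqF.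
move: (Num.sqrt (sumsq x))^-1 c0 => c c0 s1; exists c; split => //.
  by move=> u /hx ->; rewrite mulr0.
move=> u; rewrite -(@expr_le1 _ 2)// real_normK ?num_real// -s1 /sumsq (bigD1 u)//=.
by rewrite lerDl sumr_ge0// => *; exact: sqr_ge0.
Qed.

(* Minimize [w] over the compact set of pairs [(w, x)], [x] on the unit
   sphere, with [dtn_form w x x <= 0]: at the minimum the form is positive
   semidefinite with [x] as an isotropic vector. *)
Lemma dtn_form_first_kernel w2 x0 v0 : 0 < w2 -> (forall e : edge G, w2 * len e < pi) ->
  v0 \in VD -> vanishing x0 -> (exists v, x0 v != 0) -> dtn_form w2 x0 x0 <= 0 ->
  exists w1 x1, [/\ 0 < w1 <= w2, vanishing x1, exists v, x1 v != 0 &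
    forall y, vanishing y -> dtn_form w1 x1 y = 0].
Proof.
move=> w20 w2l v0D hx0 nx0 Qx0.
pose box := `[0, w2]%classic `*` [set X : 'rV[R]_n | forall i, `[-1, 1]%classic (X ord0 i)].
(* The condition at [VD] is encoded as one closed inequality on a sum of nonnegative terms.
   Frequency 0 is included for compactness and excluded afterwards. *)
pose K := box `&` [set p | sumsq (vertex_fun p.2) = 1] `&`
  [set p | \sum_v (v \in VD)%:R * vertex_fun p.2 v ^+ 2 <= 0] `&` [set p | clamped_form w2 p <= 0].
have c2 v : continuous (fun p : R * 'rV[R]_n => vertex_fun p.2 v ^+ 2).
  by move=> p; apply: cvgM; exact: continuous_vertex_fun.
have cK : compact K.
  apply: compact_closedI; last first.
    have /continuous_closedP := @continuous_clamped_form w2 (ltW w20) w2l.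
    by move=> /(_ _ (@closed_le _ 0)).
  apply: compact_closedI; last first.
    have /continuous_closedP : continuous (fun p : R * 'rV[R]_n => \sum_v (v \in VD)%:R * vertex_fun p.2 v ^+ 2).
      by move=> p; apply: cvg_sumr => v; apply: cvgM; [exact: cvg_cst|exact: c2].
    by move=> /(_ _ (@closed_le _ 0)).
  apply: compact_closedI; last first.
    have /continuous_closedP : continuous (fun p : R * 'rV[R]_n => \sum_v vertex_fun p.2 v ^+ 2).
      by move=> p; apply: cvg_sumr => v; exact: c2.
    by move=> /(_ _ (@closed_eq _ 1)).
  apply: compact_setX; first exact: segment_compact.
  exact: (@rV_compact R n (fun=> `[-1, 1]%classic) (fun=> @segment_compact R (-1) 1)).
(* Any nonzero vector with nonpositive form can be rescaled into [K]. This serves twice: for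
   nonemptiness, and against minimality at the end. *)
have inK w y : 0 < w <= w2 -> vanishing y -> (exists v, y v != 0) ->
    dtn_form w y y <= 0 -> exists c, K (w, vertex_row (fun v => c * y v)).
  move=> /andP[w0 ww] hy ny Qy.
  have [c [c0 hc sc cle]] := unit_sphere_scaling hy ny.
  exists c; split; [split; [split|]|] => /=.
  - split => /=; first by rewrite in_itv /= (ltW w0).
    by move=> i; rewrite mxE in_itv /= -ler_norml cle.
  - by rewrite vertex_fun_row.
  - rewrite vertex_fun_row big1// => v _; case: (boolP (v \in VD)) => [/hc ->|_].
      by rewrite expr0n mulr0.
    by rewrite mul0r.
  - by rewrite clamped_formE ?w0// vertex_fun_row dtn_formZ mulr_ge0_le0 ?sqr_ge0.
have K0 : K !=set0.
  by have [|c Kc] := inK _ _ _ hx0 nx0 Qx0; [rewrite w20 lexx|eexists; exact: Kc].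
have [[w1 X1] KX min1] := compact_EVT_min K0 cK
  (@continuous_subspaceT _ _ K fst (fun p => cvg_fst)).
have {KX} [[[[/= w1w _] s1] D1] Q1] : K (w1, X1) by exact: set_mem.
have hX1 : vanishing (vertex_fun X1).
  have p0 v : 0 <= (v \in VD)%:R * vertex_fun X1 v ^+ 2 by rewrite mulr_ge0// sqr_ge0.
  move=> v vD; apply/eqP; rewrite -sqrf_eq0.
  have : \sum_v (v \in VD)%:R * vertex_fun X1 v ^+ 2 == 0.
    by rewrite eq_le D1 sumr_ge0// => *; exact: p0.
  rewrite psumr_eq0; last by move=> *; exact: p0.
  by move=> /allP/(_ v (mem_index_enum v)); rewrite vD mul1r.
have nX1 : exists v, vertex_fun X1 v != 0.
  apply: contrapT => /vertex_fun_eq0 X0.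
  move: s1; rewrite /sumsq big1 => [/eqP|v _]; first by rewrite eq_sym oner_eq0.
  by rewrite X0 expr0n.
(* At frequency 0 the form is the sum of [(len e)^-1] times the squared differences along edges; if
   it is nonpositive, the vector is constant, hence 0 because of [v0]. *)
have w1gt0 : 0 < w1.
  move: w1w; rewrite in_itv /= => /andP[]; rewrite le_eqVlt => /predU1P[w10 _|//].
  move: Q1; rewrite -w10 => Q1.
  have : \sum_(e : edge G) (len e)^-1 * (vertex_fun X1 (src e) - vertex_fun X1 (tgt e)) ^+ 2 = 0.
    apply/eqP; rewrite eq_le sumr_ge0 ?andbT; last first.
      by move=> e _; rewrite mulr_ge0 ?sqr_ge0// invr_ge0 len_ge0.
    apply: le_trans Q1; rewrite le_eqVlt; apply/orP; left; apply/eqP.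
    apply: eq_bigr => e _ /=.
    by rewrite min_l ?(ltW w20)// max_l// /sinc eqxx mul0r cos0; ring.
  move/eqP; rewrite psumr_eq0; last first.
    by move=> e _; rewrite mulr_ge0 ?sqr_ge0// invr_ge0 len_ge0.
  move=> /allP h.
  have e0 e : vertex_fun X1 (tgt e) = vertex_fun X1 (src e).
    have /= := h e (mem_index_enum e).
    by rewrite mulf_eq0 invr_eq0 gt_eqF ?len_gt0//= sqrf_eq0 subr_eq0 => /eqP.
  by case: nX1 => v; rewrite (connected_cst e0 v v0) hX1// eqxx.
have w1w2 : w1 <= w2 by move: w1w; rewrite in_itv /= => /andP[].
have w1l (e : edge G) : w1 * len e < pi.
  by apply: le_lt_trans (w2l e); rewrite ler_wpM2r// len_ge0.
exists w1, (vertex_fun X1); split => //; first by rewrite w1gt0.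
apply: dtn_form_kernel => //; last by rewrite -(clamped_formE (w2 := w2)) ?w1gt0.
(* A negative value at some [w < w1] would yield a point of [K] with smaller frequency. *)
move=> y hy; apply: dtn_form_limit => // w /andP[w0 ww1].
rewrite leNgt; apply/negP => Qy.
have ny : exists v, y v != 0.
  apply: contrapT => /vertex_fun_eq0 y0.
  by move: Qy; rewrite /dtn_form big1 ?ltxx// => e _; rewrite !y0; ring.
have ww2 : w <= w2 by rewrite (le_trans (ltW ww1)).
have [|c /mem_set Kc] := inK w y _ hy ny (ltW Qy); first by rewrite w0.
by have := min1 _ Kc; rewrite leNgt /= ww1.
Qed.

End DtnForm.

(** * Multiplicities, leaves, and simplicity of the first eigenvalue *)

Section Spectrum.
Context {R : realType} (G : metric_graph R) (VD : {set vertex G}).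
Local Notation Re := complex.Re.
Local Notation Im := complex.Im.
Local Open Scope complex_scope.
Implicit Types (A : set R) (lam : R) (f : graph_fun G) (u : edge G -> R -> R).

Lemma multiplicity_ge_leq A m n : (m <= n)%N ->
  multiplicity_ge VD A n -> multiplicity_ge VD A m.
Proof.
move=> mn [f fi fA]; exists (fun i => f (widen_ord mn i)); last by move=> i; exact: fA.
move=> c hc i.
(* The coefficients are extended by 0 to the indices from [m] on. *)
pose c' (k : 'I_n) : R[i] := oapp c 0 (insub (k : nat)).
have c'E (k : 'I_m) : c' (widen_ord mn k) = c k by rewrite /c' /= valK.
rewrite -c'E; apply: fi => e t tl; rewrite -[RHS](hc e t tl).
rewrite (eq_bigr (fun k => c' (widen_ord mn k) * f (widen_ord mn k) e t)); last first.
  by move=> k _; rewrite c'E.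
rewrite -(big_ord_narrow (F := fun k => c' k * f k e t)) [RHS]big_mkcond /=.
apply: eq_bigr => k _; case: ifPn => // km.
by rewrite /c' insubN//= mul0r.
Qed.

Lemma multiplicity_ge1P A : multiplicity_ge VD A 1 <->
  exists2 lam, A lam & exists f, eigenfunction VD lam f.
Proof.
split; first by move=> [f _ /(_ ord0) [lam Al fl]]; exists lam => //; exists (f ord0).
move=> [lam Al [f fl]]; exists (fun=> f); last by move=> _; exists lam.
move=> c hc i; have [[e [t [tl ft]]] _] := fl.
have /eqP := hc e t tl; rewrite big_ord1 mulf_eq0 (negbTE ft) orbF => /eqP.
by rewrite (ord1 i).
Qed.

Lemma eigenfunction_weak_solution lam f : eigenfunction VD lam f ->
  (exists x, weak_solution VD lam (fun e t => Re (f e t)) x) /\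
  (exists x, weak_solution VD lam (fun e t => Im (f e t)) x).
Proof. by move=> [_ /laplacian_weak_solution]. Qed.

Lemma weak_solution_eigenfunction lam u x : weak_solution VD lam u x ->
  (exists e t, 0 <= t <= len e /\ u e t != 0) ->
  eigenfunction VD lam (fun e t => (u e t)%:C).
Proof.
move=> hu [e [t [tl ut]]]; split; last exact: weak_solution_laplacian hu.
by exists e, t; split => //; apply: contra ut => /eqP [->].
Qed.

Lemma eigenfunction_gt0 lam f v0 : v0 \in VD -> eigenfunction VD lam f -> 0 < lam.
Proof.
move=> v0D fl; have [[e [t [tl /negP ft]]] _] := fl; rewrite ltNge; apply/negP => lam0.
have [[x hx] [y hy]] := eigenfunction_weak_solution fl; apply: ft; apply/eqP.
apply: complex_ext; first exact: (weak_solution_le0 v0D lam0 hx tl).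
exact: (weak_solution_le0 v0D lam0 hy tl).
Qed.

(** If [lk < lj], the [k] independent eigenfunctions counted by [lk] would give [j] of them strictly
    below [lj]. The Dirichlet vertex [v0] makes [lj] positive. *)
Lemma eigenvalue_ratio_ge1 k j r v0 : v0 \in VD -> (0 < j <= k)%N ->
  eigenvalue_ratio VD k j r -> 1 <= r.
Proof.
move=> v0D /andP[j0 jk] [lk [lj [[hk _] [hj hj'] ->]]].
have lj0 : 0 < lj.
  have /multiplicity_ge1P [lam lamj [f fl]] := multiplicity_ge_leq j0 hj.
  exact: lt_le_trans (eigenfunction_gt0 v0D fl) lamj.
rewrite ler_pdivlMr// mul1r leNgt; apply/negP => ljk; apply: hj'.
apply: (multiplicity_ge_leq jk); have [f fi fA] := hk; exists f => // i.
by have [lam lamk fl] := fA i; exists lam => //=; exact: le_lt_trans lamk ljk.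
Qed.

(** Evaluation at the point [p] of [e0] is injective on real solutions, so all of them are multiples
    of one solution [u]; complex eigenfunctions are then complex multiples of the same [u]. *)
Lemma simple_eigenvalue lam (e0 : edge G) (p : R) : 0 <= p <= len e0 ->
  (forall u x, weak_solution VD lam u x -> u e0 p = 0 ->
     forall e t, 0 <= t <= len e -> u e t = 0) ->
  forall f : 'I_2 -> graph_fun G, lin_indep f ->
    ~ (forall i, eigenfunction VD lam (f i)).
Proof.
move=> pl inj f fi fl.
have [u [x [hu up]]] : exists u x, weak_solution VD lam u x /\ u e0 p != 0.
  have [[e [t [tl ft]]] _] := fl ord0.
  have [[x hx] [y hy]] := eigenfunction_weak_solution (fl ord0).
  have [r0|r0] := eqVneq (Re (f ord0 e0 p)) 0; last by eexists; eexists; split; [exact: hx|].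
  have [i0|i0] := eqVneq (Im (f ord0 e0 p)) 0; last by eexists; eexists; split; [exact: hy|].
  case/negP: ft; apply/eqP; apply: complex_ext; first exact: (inj _ _ hx r0 _ _ tl).
  exact: (inj _ _ hy i0 _ _ tl).
have real_multiple v y e t : weak_solution VD lam v y -> 0 <= t <= len e ->
    v e t = v e0 p / u e0 p * u e t.
  move=> hv tl; apply/eqP; rewrite -subr_eq0; apply/eqP.
  have vp : 1 * v e0 p + - (v e0 p / u e0 p) * u e0 p = 0 by field.
  have := inj _ _ (weak_solution_comb 1 (- (v e0 p / u e0 p)) hv hu) vp _ _ tl.
  by rewrite mul1r mulNr.
have multiple i e t : 0 <= t <= len e -> f i e t = f i e0 p * (u e t / u e0 p)%:C.
  move=> tl; have [[y hy] [z hz]] := eigenfunction_weak_solution (fl i).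
  apply: complex_ext; rewrite [f i e0 p * _]mulrC ?Re_mulC ?Im_mulC.
    by rewrite (real_multiple _ _ _ _ hy tl); ring.
  by rewrite (real_multiple _ _ _ _ hz tl); ring.
(* These coefficients cancel the combination at [p], hence everywhere. *)
pose c (i : 'I_2) := if i == ord0 then f ord_max e0 p else - f ord0 e0 p.
have := fi c _ ord_max; rewrite /c /= => c0.
have f0 : f ord0 e0 p = 0.
  apply/eqP; rewrite -oppr_eq0; apply/eqP; apply: c0 => e t tl.
  rewrite big_ord_recl big_ord1 /=.
  rewrite (multiple ord0 e t tl).
  have -> : lift ord0 ord0 = ord_max :> 'I_2 by apply: val_inj.
  by rewrite (multiple ord_max e t tl); ring.
have [[e [t [tl /negP ft]]] _] := fl ord0; apply: ft.
by rewrite (multiple _ _ _ tl) f0 mul0r.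
Qed.

End Spectrum.

(** * Degrees and leaves of a tree *)

Section Leaves.
Context {R : realType} (G : metric_graph R).
Implicit Types (u v : vertex G) (e : edge G).

Definition incident e v := (src e == v) || (tgt e == v).

Lemma degreeE v : degree v = (\sum_e ((src e == v) + (tgt e == v)))%N.
Proof.
rewrite /degree big_split /=; congr (_ + _)%N; rewrite -sum1_card big_mkcond;
by apply: eq_bigr => e _; rewrite inE; case: ifP.
Qed.

Lemma leaf_edge_uniq v e e' : v \in leaves G -> incident e v -> incident e' v -> e = e'.
Proof.
rewrite inE degreeE /incident => /eqP d1 ev ev'; apply/eqP/negPn/negP => ne.
move: d1; rewrite (bigD1 e) //= (bigD1 e') /= ?(eq_sym e') //.
by move: ev ev'; do 4! case: (_ == v).
Qed.

Lemma leaf_not_loop v e : v \in leaves G -> ~ (src e = v /\ tgt e = v).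
Proof.
rewrite inE degreeE => /eqP d1 [s t].
by move: d1; rewrite (bigD1 e) //= s t eqxx.
Qed.

Lemma adjacent_incident u v : Defs.adjacent (@src R G) (@tgt R G) u v ->
  exists e, (src e = u /\ tgt e = v) \/ (src e = v /\ tgt e = u).
Proof.
by move=> /existsP[e /orP[]/andP[/eqP a /eqP b]]; exists e; [left|right].
Qed.

Lemma incident_edge (e0 : edge G) v : exists e, incident e v.
Proof.
have [<-|ne] := eqVneq (src e0) v; first by exists e0; rewrite /incident eqxx.
have /connectP[[|u p] /= pp lp] := graph_connected v (src e0).
  by rewrite lp eqxx in ne.
move: pp => /andP[/adjacent_incident[e h] _]; exists e.
by case: h => [[<- _]|[_ <-]]; rewrite /incident eqxx ?orbT.
Qed.

Lemma sum_degree : (\sum_(v : vertex G) degree v = 2 * #|edge G|)%N.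
Proof.
under eq_bigr do rewrite degreeE.
rewrite exchange_big /=; transitivity (\sum_(e : edge G) 2)%N.
  apply: eq_bigr => e _; rewrite big_split /=.
  have one u : (\sum_(v : vertex G) (u == v))%N = 1%N.
    by rewrite (bigD1 u) //= eqxx big1// => v /negbTE; rewrite eq_sym => ->.
  by rewrite !one.
by rewrite sum_nat_const mulnC.
Qed.

(** The edge [e0] and connectedness exclude degree 0. If all degrees were at least 2, the handshake
    identity would give [|V| <= |E|], against [|V| = |E| + 1]. *)
Lemma tree_leaf (e0 : edge G) : is_tree G -> exists v, v \in leaves G.
Proof.
move=> /eqP tG; apply: contrapT => noleaf.
have d2 v : (2 <= degree v)%N.
  have [e ev] := incident_edge e0 v.
  have d1 : (1 <= degree v)%N.
    by rewrite degreeE (bigD1 e)//= addn_gt0; move: ev => /orP[] ->; rewrite ?orbT ?addn1.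
  by rewrite ltn_neqAle d1 andbT eq_sym; apply/negP => h; apply: noleaf; exists v; rewrite inE.
have : (\sum_(v : vertex G) 2 <= \sum_(v : vertex G) degree v)%N.
  by apply: leq_sum => v _; exact: d2.
rewrite sum_degree sum_nat_const -tG.
by rewrite mulnC leq_mul2l addn1 ltnn.
Qed.

(** The handshake identity gives [|V| = 2 |E|], to be compared with [|V| = |E| + 1]. *)
Lemma all_leaves_one_edge : is_tree G -> (forall v, v \in leaves G) -> #|edge G| = 1%N.
Proof.
move=> /eqP tG h; have := sum_degree.
rewrite (eq_bigr (fun=> 1%N)) => [|v _]; last by have := h v; rewrite inE => /eqP.
rewrite sum1_card -tG mul2n -addnn => /addnI.
by [].
Qed.

(** No path can leave an edge both of whose ends are leaves, so these ends are all the vertices. *)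
Lemma leaf_leaf_edge e v : src e \in leaves G -> tgt e \in leaves G -> v \in leaves G.
Proof.
move=> sl tl.
suff : v = src e \/ v = tgt e by case=> ->.
have /connectP[p pp ->] := graph_connected (src e) v.
have gen q u0 : path (Defs.adjacent (@src R G) (@tgt R G)) u0 q ->
    u0 = src e \/ u0 = tgt e -> last u0 q = src e \/ last u0 q = tgt e.
  elim: q u0 => //= u q IH u0 /andP[/adjacent_incident[e' h] qq] hu0.
  apply: IH qq _.
  have ee' : e = e'.
    apply: (@leaf_edge_uniq u0); first by case: hu0 => ->.
      by rewrite /incident; case: hu0 => ->; rewrite eqxx ?orbT.
    by rewrite /incident; case: h => -[a b]; rewrite ?a ?b eqxx ?orbT.
  by case: h; rewrite -ee' => -[a b]; [right|left].
by apply: gen pp _; left.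
Qed.

End Leaves.

(** The difference of the cotangents is [sin (b - a) / (sin a * sin b)]. *)
Lemma cot_decr (R : realType) (a b : R) : 0 < a -> a < b -> b < pi ->
  cos b / sin b < cos a / sin a.
Proof.
move=> a0 ab bpi.
have sa : 0 < sin a by apply: sin_gt0_pi; rewrite a0 (lt_trans ab).
have sb : 0 < sin b by apply: sin_gt0_pi; rewrite bpi (lt_trans a0).
have sba : 0 < sin (b - a) by apply: sin_gt0_pi; apply/andP; split; lra.
rewrite ltr_pdivrMr// mulrAC ltr_pdivlMr//.
by move: sba; rewrite sinB; lra.
Qed.

(** * Simplicity of the first eigenvalue of a Dirichlet tree *)

Section DirichletTree.
Context {R : realType} (G : metric_graph R).
Local Notation VD := (leaves G).
Variable w : R.
Hypothesis w0 : 0 < w.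
Hypothesis first : ~ multiplicity_ge VD [set x | x < w ^+ 2] 1.
Variable e0 : edge G.
Implicit Types (x y z : vertex G -> R).

(** The profiles of a nonzero kernel vector form an eigenfunction for [w1 ^+ 2], below the assumed
    bottom of the spectrum. *)
Lemma no_smaller_kernel w1 x : 0 < w1 < w -> (forall e : edge G, w1 * len e < pi) ->
  vanishing VD x -> (exists v, x v != 0) ->
  ~ (forall y, vanishing VD y -> dtn_form w1 x y = 0).
Proof.
move=> /andP[w10 w1w] w1l hx [v xv] hker; apply: first.
have s0 (e : edge G) : sin (w1 * len e) != 0.
  by rewrite gt_eqF// sin_gt0_pi// w1l mulr_gt0// len_gt0.
apply/multiplicity_ge1P; exists (w1 ^+ 2).
  by rewrite /= ltr_pXn2r// nnegrE ltW.
eexists; apply: weak_solution_eigenfunction (profile_weak_solution s0 hx hker) _.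
have [e /orP[]/eqP ev] := incident_edge e0 v.
  by exists e, 0; rewrite lexx len_ge0 profile0 ev.
by exists e, (len e); rewrite lexx len_ge0 profile_end// ev.
Qed.

(** A nonpositive value would produce a kernel vector at some frequency at most [w1]. *)
Lemma dtn_form_pos w1 x : 0 < w1 < w -> (forall e : edge G, w1 * len e < pi) ->
  (exists v, v \in VD) ->
  vanishing VD x -> (exists v, x v != 0) -> 0 < dtn_form w1 x x.
Proof.
move=> /andP[w10 w1w] w1l [v0 v0D] hx nx; rewrite ltNge; apply/negP => Qx.
have [w' [x' [/andP[w'0 w'w] hx' nx' ker]]] :=
  dtn_form_first_kernel w10 w1l v0D hx nx Qx.
apply: (no_smaller_kernel _ _ hx' nx' ker); first by rewrite w'0 (le_lt_trans w'w).
by move=> e; apply: le_lt_trans (w1l e); rewrite ler_wpM2r// len_ge0.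
Qed.

(* Evaluate the form at the indicator of the interior vertices, at
   frequencies approaching [pi / len em] from below: the longest edge [em]
   sends it to minus infinity. *)
Lemma first_frequency_lt (em : edge G) v : v \notin VD -> (exists v, v \in VD) ->
  (forall e : edge G, len e <= len em) -> w * len em < pi.
Proof.
move=> vI exD lm; rewrite ltNge; apply/negP => wl.
have lm0 := len_gt0 em; have p0 := @pi_gt0 R.
pose W := pi / len em.
have W0 : 0 < W by rewrite divr_gt0.
have Ww : W <= w by rewrite ler_pdivrMr.
have hW : 0 < W / 2 by rewrite divr_gt0.
(* [C e] bounds the contribution of [e] at all frequencies between [W / 2] and [W], as the cotangent
   decreases. [M] is chosen so that [W / 2 * M] exceeds the sum of these bounds by [W / 2]. *)
pose C (e : edge G) := W * `|cos (W / 2 * len e) / sin (W / 2 * len e)|.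
have C0 e : 0 <= C e by rewrite mulr_ge0// ltW.
pose M := 2 * (\sum_e C e) / W + 1.
have M0 : 0 < M.
  by rewrite ltr_pwDr// divr_ge0 ?(ltW W0)// mulr_ge0// sumr_ge0.
(* The cotangent of [d] is [M]. The frequency [w2] below satisfies [w2 * len em = pi - d], so the
   cotangent on [em] is [- M]. *)
pose d := atan M^-1.
have d0 : 0 < d by rewrite -(@atan0 R) lt_atan// invr_gt0.
have dpi : d < pi / 2 by exact: atan_ltpi2.
have sd : 0 < sin d by rewrite sin_gt0_pi// d0; lra.
have cd : 0 < cos d by rewrite cos_gt0_pihalf//; apply/andP; split; lra.
have cotd : cos d / sin d = M.
  by have := atanK M^-1; rewrite -/d /tan => h; rewrite -[RHS]invrK -h invf_div.
pose w2 := (pi - d) / len em.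
have w2lm : w2 * len em = pi - d by rewrite /w2 divfK// gt_eqF.
have w2W : w2 < W by rewrite /w2 /W ltr_pM2r ?invr_gt0//; lra.
have Ww2 : W / 2 < w2.
  by rewrite /w2 /W mulrAC ltr_pM2r ?invr_gt0//; lra.
have w20 : 0 < w2 by exact: lt_trans Ww2.
have w2l (e : edge G) : w2 * len e < pi.
  apply: (@le_lt_trans _ _ (w2 * len em)); first by rewrite ler_pM2l.
  by rewrite w2lm; lra.
have se (e : edge G) : 0 < sin (w2 * len e).
  by rewrite sin_gt0_pi// w2l mulr_gt0// len_gt0.
pose y (u : vertex G) : R := (u \notin VD)%:R.
have hy : vanishing VD y by move=> u uD; rewrite /y uD.
have ny : exists u, y u != 0 by exists v; rewrite /y vI oner_eq0.
have w2w : 0 < w2 < w by rewrite w20 (lt_le_trans w2W).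
have := dtn_form_pos w2w w2l exD hy ny.
rewrite ltNge => /negP; apply.
pose T (e : edge G) := w2 * ((y (src e) * y (src e) + y (tgt e) * y (tgt e)) * cos (w2 * len e)
       - (y (src e) * y (tgt e) + y (tgt e) * y (src e))) / sin (w2 * len e).
have TC e : T e <= C e.
  have cote : cos (w2 * len e) / sin (w2 * len e) <=
      `|cos (W / 2 * len e) / sin (W / 2 * len e)|.
    apply: le_trans (ler_norm _); apply/ltW/cot_decr => //.
      by rewrite mulr_gt0// len_gt0.
    by rewrite ltr_pM2r// len_gt0.
  have cotC : w2 * cos (w2 * len e) / sin (w2 * len e) <= C e.
    rewrite -mulrA; apply: (@le_trans _ _ (w2 * `|cos (W / 2 * len e) / sin (W / 2 * len e)|)).
      by rewrite ler_pM2l.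
    by rewrite ler_wpM2r// ltW.
  rewrite /T /y; do 2! case: (_ \notin _) => /=.
  - apply: le_trans (C0 e); rewrite mulr_le0_ge0 ?invr_ge0 ?(ltW (se e))//.
    by rewrite mulr_ge0_le0 ?(ltW w20)//; have := cos_le1 (w2 * len e); lra.
  - by rewrite !(mulr1, mulr0, addr0, add0r, subr0, mul1r).
  - by rewrite !(mulr1, mulr0, addr0, add0r, subr0, mul1r).
  - by rewrite !(mulr0, mul0r, addr0, subr0).
have Tm : T em <= - (W / 2 * M).
  have cotm : w2 * cos (w2 * len em) / sin (w2 * len em) = - (w2 * M).
    by rewrite w2lm cosB sinB cospi sinpi -cotd; field; lra.
  have le1 : - (w2 * M) <= - (W / 2 * M) by rewrite lerN2 ler_pM2r// ltW.
  (* Two leaf ends would make every vertex a leaf, including the interior vertex [v]. *)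
  have : (src em \notin VD) || (tgt em \notin VD).
    by rewrite -negb_and; apply/negP => /andP[a b]; rewrite (leaf_leaf_edge v a b) in vI.
  rewrite /T /y; case: (src em \notin VD); case: (tgt em \notin VD) => //= _.
  - apply: le_trans le1; rewrite -cotm ler_pM2r ?invr_gt0// ler_pM2l//.
    have : cos (w2 * len em) <= 1 by exact: cos_le1.
    by lra.
  - by rewrite !(mulr1, mulr0, addr0, add0r, subr0, mul1r) cotm.
  - by rewrite !(mulr1, mulr0, addr0, add0r, subr0, mul1r) cotm.
rewrite /dtn_form -/T (bigD1 em) //=.
apply: (@le_trans _ _ (- (W / 2 * M) + \sum_(e | e != em) C e)).
  by apply: lerD => //; apply: ler_sum => e _; exact: TC.
have : \sum_(e | e != em) C e <= \sum_e C e by rewrite [leRHS](bigD1 em)//= lerDr.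
have -> : W / 2 * M = \sum_e C e + W / 2 by rewrite /M; field; rewrite gt_eqF.
by lra.
Qed.

Lemma longest_edge : exists em : edge G, forall e : edge G, len e <= len em.
Proof.
by case: (@Order.TotalTheory.arg_maxP _ _ _ e0 predT (@len R G)) => // em _ h; exists em => e; exact: h.
Qed.

(* If [x] is a kernel vector, so is [|x|], since the off-diagonal terms are
   negative; being nonnegative, [|x|] vanishes at all neighbours of an interior
   zero. *)
Lemma interior_zero u x v : is_tree G -> weak_solution VD (w ^+ 2) u x ->
  v \notin VD -> x v = 0 -> forall e t, 0 <= t <= len e -> u e t = 0.
Proof.
move=> tG hu vI xv.
have exD := tree_leaf e0 tG.
have [em lm] := longest_edge.
have wl (e : edge G) : w * len e < pi.
  apply: le_lt_trans (first_frequency_lt vI exD lm).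
  by rewrite ler_pM2l.
have se (e : edge G) : 0 < sin (w * len e).
  by rewrite sin_gt0_pi// wl mulr_gt0// len_gt0.
have se' (e : edge G) : sin (w * len e) != 0 by rewrite gt_eqF.
have psd y : vanishing VD y -> 0 <= dtn_form w y y.
  move=> hy; apply: dtn_form_limit => // w' /andP[w'0 w'w].
  have [ny|/vertex_fun_eq0 y0] := pselect (exists v, y v != 0).
    apply/ltW/dtn_form_pos => //; first by rewrite w'0.
    by move=> e; apply: le_lt_trans (wl e); rewrite ler_wpM2r ?len_ge0// ltW.
  by rewrite /dtn_form big1// => e _; rewrite !y0; ring.
have [uE ker] := weak_solution_profile w0 se' hu.
have hx : vanishing VD x by have [du []] := hu.
pose z (v : vertex G) := `|x v|.
have hz : vanishing VD z by move=> a aD; rewrite /z hx// normr0.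
have kerz : forall y, vanishing VD y -> dtn_form w z y = 0.
  apply: dtn_form_kernel => //.
  by apply: le_trans (dtn_form_norm x w0 wl) _; rewrite ker.
(* Test against the indicator of [a]: as [z a = 0], only off-diagonal terms remain. They have one
   sign and sum to 0, so each of them vanishes. *)
have neighbour a b e : a \notin VD -> z a = 0 ->
    (src e = a /\ tgt e = b) \/ (src e = b /\ tgt e = a) -> z b = 0.
  move=> aI za hab.
  pose y (c : vertex G) : R := (c == a)%:R.
  have hy : vanishing VD y.
    by move=> c cD; rewrite /y; case: eqVneq => // ca; rewrite -ca cD in aI.
  have zy c : z c * y c = 0.
    by rewrite /y; case: eqVneq => [->|_]; rewrite ?za ?mul0r ?mulr0.
  have := kerz _ hy; rewrite /dtn_form.
  under eq_bigr do rewrite !zy addr0 mul0r add0r mulrN mulNr.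
  rewrite sumrN => /eqP; rewrite oppr_eq0 psumr_eq0; last first.
    move=> e' _; rewrite divr_ge0 ?(ltW (se e'))// mulr_ge0 ?(ltW w0)//.
    by apply: addr_ge0; apply: mulr_ge0; rewrite /z /y.
  move=> /allP/(_ e (mem_index_enum e))/=.
  rewrite mulf_eq0 invr_eq0 (negbTE (se' e)) orbF mulf_eq0 gt_eqF//=.
  case: hab => -[-> ->]; rewrite /y eqxx !mulr1 paddr_eq0 ?/z ?mulr_ge0//.
    by move=> /andP[_ /eqP].
  by move=> /andP[/eqP].
(* The indicator of a leaf is not an admissible test vector, so [neighbour] stops at leaves. The
   invariant therefore also records that the neighbours of a leaf vanish; they reduce to the vertex
   from which the leaf was reached. *)
pose Z (a : vertex G) := z a = 0 /\
  (a \in VD -> forall e b, (src e = a /\ tgt e = b) \/ (src e = b /\ tgt e = a) -> z b = 0).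
have ZV : Z v by split; [rewrite /z xv normr0|rewrite (negbTE vI)].
have step a b : Defs.adjacent (@src R G) (@tgt R G) a b -> Z a -> Z b.
  move=> /adjacent_incident[e hab] [za Za].
  have zb : z b = 0.
    have [aD|aI] := boolP (a \in VD); first exact: (Za aD e).
    exact: (neighbour a b e).
  split => // bD e' c hbc.
  have ee' : e = e'.
    apply: (leaf_edge_uniq bD); rewrite /incident.
      by case: hab => -[-> ->]; rewrite eqxx ?orbT.
    by case: hbc => -[-> ->]; rewrite eqxx ?orbT.
  have -> // : c = a.
  have nl := @leaf_not_loop _ _ b e bD.
  by rewrite -ee' in hbc; case: hab => -[s1 t1]; case: hbc => -[s2 t2]; [
    case: nl; rewrite s2 t1 | rewrite -s1 -s2 | rewrite -t1 -t2 | case: nl; rewrite s1 t2].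
have x0 a : x a = 0.
  have /connectP[p pp ->] := graph_connected v a.
  suff : Z (last v p) by case=> /eqP; rewrite normr_eq0 => /eqP.
  elim: p v pp ZV {xv vI} => //= b p IH v' /andP[vb pp] Zv'.
  exact: IH pp (step _ _ vb Zv').
by move=> e t tl; rewrite uE// !x0 /profile /trig !mul0r subrr !mul0r addr0.
Qed.

(** Evaluation at an interior vertex is injective by [interior_zero]. Without interior vertex the
    tree is a single edge, and the kink relation gives injectivity at a point close enough to its
    end. *)
Lemma tree_simple : is_tree G -> exists e p, 0 <= p <= len e /\
  forall u x, weak_solution VD (w ^+ 2) u x -> u e p = 0 ->
    forall e t, 0 <= t <= len e -> u e t = 0.
Proof.
move=> tG.
have [[v vI]|allD] := pselect (exists v, v \notin VD).
  have [e /orP[]/eqP ev] := incident_edge e0 v.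
    exists e, 0; rewrite lexx len_ge0; split => // u x hu u0.
    apply: (interior_zero tG hu vI); have [du [_ /(_ e)[h _] _] _] := hu.
    by rewrite -ev -h.
  exists e, (len e); rewrite lexx len_ge0; split => // u x hu u0.
  apply: (interior_zero tG hu vI); have [du [_ /(_ e)[_ h] _] _] := hu.
  by rewrite -ev -h.
have allD' v : v \in VD by apply/negPn/negP => h; apply: allD; exists v.
have E1 := all_leaves_one_edge tG allD'.
have l0 := len_gt0 e0; have p0 := @pi_gt0 R.
pose c := Num.min (len e0) (pi / 2 / w).
have c0 : 0 < c by rewrite lt_min l0 !divr_gt0.
have sc : 0 < sin (w * c).
  apply: sin_gt0_pi; rewrite mulr_gt0//=.
  have : w * c <= pi / 2 by rewrite mulrC -ler_pdivlMr// ge_min lexx orbT.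
  by move/le_lt_trans; apply; lra.
have cl : c <= len e0 by rewrite ge_min lexx.
have ql : 0 <= len e0 - c <= len e0 by apply/andP; split; lra.
exists e0, (len e0 - c); split => // u x hu u0 e t.
have -> : e = e0.
  by move/eqP: E1 => /fintype1P [a ha]; rewrite (ha e) (ha e0).
move=> tl; have := weak_solution_kink w0 hu tl ql.
have [du [_ /(_ e0)[_ ->] ->//] _] := hu.
rewrite u0 !mul0r subrr mulr0 sub0r subKr => /eqP.
by rewrite mulf_eq0 (gt_eqF sc) oppr_eq0 => /eqP.
Qed.

End DirichletTree.

(** * Stars *)

Section Star.
Context {R : realType} (n : nat) (L : 'I_n -> R) (L_gt0 : forall i, 0 < L i).
Local Open Scope complex_scope.

(** Edge lengths are arbitrary, which the perturbed star needs; [star] is convertible to the case of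
    constant [L]. *)
Definition metric_star : metric_graph R := MetricGraph L_gt0 (@star_connected n).
Local Notation G := metric_star.
Local Notation center := (None : vertex G).
Local Notation outer i := (Some i : vertex G).

Lemma metric_star_tree : is_tree G.
Proof. by rewrite /is_tree /= card_option addn1. Qed.

Lemma in_leaves_star (v : vertex G) : (1 < n)%N -> (v \in leaves G) = (v != center).
Proof.
move=> n1; rewrite inE degreeE; case: v => [i|] /=.
  rewrite (bigD1 i) //= eqxx big1 // => e /negbTE ne.
  by rewrite /star_src /star_tgt /= (inj_eq Some_inj) ne.
rewrite (eq_bigr (fun=> 1%N)) // sum1_card /= card_ord; apply/negbTE.
by rewrite neq_ltn n1 orbT.
Qed.

Variables (l : R) (l_gt0 : 0 < l) (i0 : 'I_n).
Hypothesis L_le : forall i, L i <= l.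

Let wl_lt w (i : 'I_n) : 0 < w -> w * l < pi -> 0 < w * L i < pi.
Proof.
move=> w0 wl; rewrite mulr_gt0//=; apply: le_lt_trans wl.
by rewrite ler_pM2l.
Qed.

Lemma sin_star_gt0 w (i : 'I_n) : 0 < w -> w * l < pi -> 0 < sin (w * L i).
Proof. by move=> w0 wl; apply: sin_gt0_pi; exact: wl_lt. Qed.

Let half_l : 0 <= l / 2 <= l.
Proof.
by rewrite divr_ge0 ?(ltW l_gt0)//= ler_pdivrMr// mulr_natr mulr2n lerDl ltW.
Qed.

(** Half-period sines of amplitude [B i] live on the edges of length [l]. They vanish at the center,
    where the Kirchhoff condition reads [\sum_i B i = 0] unless the center is itself Dirichlet. *)
Lemma sine_weak_solution (VD : {set vertex G}) (B : 'I_n -> R) :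
  (forall i, B i != 0 -> L i = l) -> (forall i, outer i \in VD) ->
  (center \in VD \/ \sum_i B i = 0) ->
  weak_solution VD ((pi / l) ^+ 2) (fun e : edge G => trig (pi / l) 0 (B e)) (fun=> 0).
Proof.
move=> BL outD cD; apply: (@trig_weak_solution R G VD (pi / l) (fun=> 0) B) => //.
- move=> e; rewrite /trig mul0r add0r; have [->|/BL] := eqVneq (B e) 0.
    by rewrite mul0r.
  by rewrite /len /= => ->; rewrite divfK ?gt_eqF// sinpi mulr0.
- move=> y hy; rewrite (eq_bigr (fun e => - (y center * (pi / l)) * B e)); last first.
    by move=> e _; rewrite (hy _ (outD e)) mul0r sub0r /= mulrA mulNr.
  rewrite -mulr_sumr; case: cD => [cD|->]; last by rewrite mulr0.
  by rewrite (hy _ cD) !mul0r oppr0 mul0r.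
Qed.

Lemma sine_eigenfunction (VD : {set vertex G}) (B : 'I_n -> R) i :
  (forall i, B i != 0 -> L i = l) -> (forall i, outer i \in VD) ->
  (center \in VD \/ \sum_i B i = 0) -> B i != 0 ->
  eigenfunction VD ((pi / l) ^+ 2) (fun e t => (trig (pi / l) 0 (B e) t)%:C).
Proof.
move=> BL outD cD Bi.
apply: weak_solution_eigenfunction (sine_weak_solution BL outD cD) _.
exists i, (l / 2); rewrite {1}/len /= (BL _ Bi) /trig mul0r add0r; split => //.
by rewrite (_ : pi / l * (l / 2) = pi / 2) ?sin_pihalf ?mulr1//; field; rewrite gt_eqF.
Qed.

(** Below the threshold the frequency [w = sqrt lam] makes no [sin (w * L i)] vanish; the real or
    the imaginary part of [f] supplies a nonzero real solution. *)
Lemma low_eigenfunction (VD : {set vertex G}) lam f : (forall i, outer i \in VD) ->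
  eigenfunction VD lam f -> lam < (pi / l) ^+ 2 ->
  exists w u x, [/\ 0 < w, w * l < pi, lam = w ^+ 2, weak_solution VD lam u x &
    ~ (forall (e : edge G) t, 0 <= t <= len e -> u e t = 0)].
Proof.
move=> outD fl lamlt; have lam0 := eigenfunction_gt0 (outD i0) fl.
have w2 : lam = Num.sqrt lam ^+ 2 by rewrite sqr_sqrtr// ltW.
have w0 : 0 < Num.sqrt lam by rewrite sqrtr_gt0.
have wl : Num.sqrt lam * l < pi.
  rewrite -ltr_pdivlMr// -(@ltr_pXn2r _ 2)// ?nnegrE ?sqrtr_ge0 ?divr_ge0 ?pi_ge0 ?(ltW l_gt0)//.
  by rewrite -w2.
have [[x hx] [y hy]] := eigenfunction_weak_solution fl.
have [[e [t [tl /negP ft]]] _] := fl.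
have [r0|r0] := pselect (forall (e : edge G) t, 0 <= t <= len e -> complex.Re (f e t) = 0).
  exists (Num.sqrt lam), (fun e t => complex.Im (f e t)), y; split => // i0'.
  by apply: ft; apply/eqP/complex_ext; [exact: r0|exact: i0'].
by exists (Num.sqrt lam), (fun e t => complex.Re (f e t)), x; split.
Qed.

Lemma star_weak_solution (VD : {set vertex G}) w u x : 0 < w -> w * l < pi ->
  (forall i, outer i \in VD) -> weak_solution VD (w ^+ 2) u x ->
  x center = 0 -> forall (e : edge G) t, 0 <= t <= len e -> u e t = 0.
Proof.
move=> w0 wl outD hu xc e t tl.
have se (e' : edge G) : sin (w * len e') != 0 by rewrite gt_eqF// sin_star_gt0.
have [uE _] := weak_solution_profile w0 se hu.
have [du [_ _ hx] _] := hu.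
have [xs xt] : x (src e) = 0 /\ x (tgt e) = 0 by split; [exact: xc|exact: hx (outD e)].
by rewrite uE// xs xt /profile /trig !mul0r subrr !mul0r addr0.
Qed.

(** The secular function of the Dirichlet star: its zeros below [pi / l] are the frequencies of the
    eigenvalues below [(pi / l) ^+ 2]. *)
Definition cot_sum w : R := \sum_i cos (w * L i) / sin (w * L i).

Lemma cot_sum_decr w w' : 0 < w -> w < w' -> w' * l < pi -> cot_sum w' < cot_sum w.
Proof.
move=> w0 ww w'l; have w'0 := lt_trans w0 ww.
have lt_i i : cos (w' * L i) / sin (w' * L i) < cos (w * L i) / sin (w * L i).
  have /andP[_ ?] := wl_lt i w'0 w'l.
  by apply: cot_decr => //; [rewrite mulr_gt0|rewrite ltr_pM2r].
rewrite /cot_sum (bigD1 i0) //= [ltRHS](bigD1 i0) //=.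
by apply: ltr_leD => //; apply: ler_sum => i _; exact/ltW.
Qed.

(** * Spectrum of a star with Dirichlet conditions at its leaves *)

Section DirichletStar.
Hypothesis n_gt1 : (1 < n)%N.

Let outD i : outer i \in leaves G.
Proof. by rewrite in_leaves_star. Qed.

(** Only the center value is free, so the form is one-dimensional. *)
Lemma dtn_form_star w x y : vanishing (leaves G) x -> vanishing (leaves G) y ->
  dtn_form w x y = w * x center * y center * cot_sum w.
Proof.
move=> hx hy; rewrite /cot_sum mulr_sumr; apply: eq_bigr => e _ /=.
rewrite !(hx _ (outD e)) !(hy _ (outD e)) /star_src; ring.
Qed.

Lemma star_secular w u x : 0 < w -> w * l < pi ->
  weak_solution (leaves G) (w ^+ 2) u x ->
  ~ (forall (e : edge G) t, 0 <= t <= len e -> u e t = 0) -> cot_sum w = 0.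
Proof.
move=> w0 wl hu nz.
have se (e' : edge G) : sin (w * len e') != 0 by rewrite gt_eqF// sin_star_gt0.
have [uE ker] := weak_solution_profile w0 se hu.
have [du [_ _ hx] _] := hu.
have xc : x center != 0.
  by apply/eqP => xc; apply: nz; exact: star_weak_solution w0 wl outD hu xc.
pose y (v : vertex G) : R := (v == center)%:R.
have hy : vanishing (leaves G) y.
  by move=> v; rewrite in_leaves_star// /y => /negbTE ->.
have := ker y hy; rewrite dtn_form_star// /y eqxx mulr1 => /eqP.
by rewrite mulf_eq0 mulf_eq0 (gt_eqF w0) (negbTE xc) /= => /eqP.
Qed.

Variable w0 : R.
Hypotheses (w0_gt0 : 0 < w0) (w0_lt : w0 * l < pi) (w0_cot : cot_sum w0 = 0).

Lemma w0_lt_sqr : w0 ^+ 2 < (pi / l) ^+ 2.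
Proof.
by rewrite ltr_pXn2r ?nnegrE ?(ltW w0_gt0) ?divr_ge0 ?pi_ge0 ?(ltW l_gt0)// ltr_pdivlMr.
Qed.

(** The secular function is strictly decreasing, so [w0] is its only zero below [pi / l]. *)
Lemma star_low_eigenvalue lam f : eigenfunction (leaves G) lam f ->
  lam < (pi / l) ^+ 2 -> lam = w0 ^+ 2.
Proof.
move=> fl lamlt.
have [w [u [x [w_gt0 wl -> hu nz]]]] := low_eigenfunction outD fl lamlt.
congr (_ ^+ 2); case: (ltgtP w w0) => // ww.
  have := cot_sum_decr w_gt0 ww w0_lt.
  by rewrite w0_cot (star_secular w_gt0 wl hu nz)// ltxx.
have := cot_sum_decr w0_gt0 ww wl.
by rewrite w0_cot (star_secular w_gt0 wl hu nz)// ltxx.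
Qed.

Definition ground (e : edge G) : R -> R := profile w0 (L e) 1 0.

Lemma ground_eigenfunction :
  eigenfunction (leaves G) (w0 ^+ 2) (fun e t => (ground e t)%:C).
Proof.
have se (e' : edge G) : sin (w0 * len e') != 0 by rewrite gt_eqF// sin_star_gt0.
pose x (v : vertex G) : R := (v == center)%:R.
have hx : vanishing (leaves G) x.
  by move=> v; rewrite in_leaves_star// /x => /negbTE ->.
have hu : weak_solution (leaves G) (w0 ^+ 2) ground x.
  apply: profile_weak_solution => // y hy.
  by rewrite dtn_form_star// w0_cot mulr0.
apply: weak_solution_eigenfunction hu _.
by exists i0, 0; rewrite lexx len_ge0 /ground profile0 oner_eq0.
Qed.

Lemma star_first_eigenvalue : kth_eigenvalue (leaves G) 1 (w0 ^+ 2).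
Proof.
split.
  apply/multiplicity_ge1P; exists (w0 ^+ 2) => /=; first exact: lexx.
  by eexists; exact: ground_eigenfunction.
move=> /multiplicity_ge1P[lam /= lamlt [f fl]].
have lamE := star_low_eigenvalue fl (lt_trans lamlt w0_lt_sqr).
by rewrite lamE ltxx in lamlt.
Qed.

Lemma star_simple : ~ multiplicity_ge (leaves G) [set x | x < (pi / l) ^+ 2] 2.
Proof.
move=> [f fi fA].
have fl i : eigenfunction (leaves G) (w0 ^+ 2) (f i).
  by have [lam /= lamlt fl] := fA i; rewrite -(star_low_eigenvalue fl lamlt).
apply: (simple_eigenvalue (e0 := (i0 : edge G)) (p := 0) _ _ fi fl).
  by rewrite lexx len_ge0.
move=> u x hu u0; apply: (star_weak_solution w0_gt0 w0_lt outD hu).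
by have [du [_ /(_ i0)[<- _] _] _] := hu.
Qed.

(** The ground state is completed by [k - 1] sines, each carried with opposite amplitudes by the
    edge 0 and another long edge. *)
Lemma star_multiplicity k : (0 < k <= n)%N -> (forall i : 'I_n, (i < k)%N -> L i = l) ->
  multiplicity_ge (leaves G) [set x | x <= (pi / l) ^+ 2] k.
Proof.
case: k => // k kn longL.
(* [B 0] is identically 0; the index 0 is assigned to the ground state instead. *)
pose B (m : 'I_k.+1) (e : 'I_n) : R := (e == m :> nat)%:R - (e == 0 :> nat)%:R.
pose f (m : 'I_k.+1) : graph_fun G := if m == ord0 then fun e t => (ground e t)%:C
  else fun e t => (trig (pi / l) 0 (B m e) t)%:C.
pose o : 'I_n := widen_ord kn ord0.
exists f; last first.
  move=> m; rewrite /f; have [m0|m0] := eqVneq m ord0.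
    exists (w0 ^+ 2); first exact/ltW/w0_lt_sqr.
    exact: ground_eigenfunction.
  exists ((pi / l) ^+ 2); first exact: lexx.
  have m0' : (m : nat) != 0 by apply: contra m0 => /eqP h; apply/eqP/val_inj.
  apply: (@sine_eigenfunction _ _ (widen_ord kn m)) => //.
  - move=> e; rewrite /B => be; apply: longL; apply: contraR be; rewrite -leqNgt => ke.
    by rewrite !gtn_eqF ?subrr// (leq_trans _ ke).
  - right; rewrite /B sumrB (bigD1 (widen_ord kn m)) //= eqxx big1; last first.
      by move=> e /negbTE; rewrite -val_eqE /= => ->.
    rewrite (bigD1 o) //= big1 ?addr0 ?subrr//.
    by move=> e /negbTE; rewrite -val_eqE /= => ->.
  - by rewrite /B /= eqxx (negbTE m0') subr0 oner_eq0.
move=> c hc.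
(* At the center only the ground state is nonzero. Once its coefficient is gone, the midpoint of
   edge [m] isolates the sine of index [m]. *)
have c0 : c ord0 = 0.
  have := hc o 0; rewrite lexx len_ge0 => /(_ isT).
  rewrite (bigD1 ord0) //= big1 ?addr0.
    by rewrite /f /= /ground profile0 mulr1.
  by move=> m /negbTE m0; rewrite /f m0 /trig mulr0 sin0 !(mul0r, mulr0) addr0 mulr0.
move=> m; have [->//|m0] := eqVneq m ord0.
have m0' : (m : nat) != 0 by apply: contra m0 => /eqP h; apply/eqP/val_inj.
have := hc (widen_ord kn m) (l / 2).
rewrite {1}/len /= (longL (widen_ord kn m) (ltn_ord m)).
rewrite half_l.
move=> /(_ isT).
have s1 : sin (pi / l * (l / 2)) = 1 :> R.
  by rewrite (_ : pi / l * (l / 2) = pi / 2) ?sin_pihalf//; field; rewrite gt_eqF.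
rewrite (bigD1 m) //= big1 ?addr0.
  by rewrite /f (negbTE m0) /trig /B /= eqxx (negbTE m0') s1 subr0 mul0r add0r !mulr1.
move=> m' mm'; rewrite /f; have [->|_] := eqVneq m' ord0; first by rewrite c0 mul0r.
rewrite /trig /B /= (negbTE m0') subr0 mul0r add0r s1 mulr1.
by rewrite eq_sym val_eqE (negbTE mm') mulr0.
Qed.

Lemma star_kth_eigenvalue k j : (1 < j <= k)%N -> (k <= n)%N ->
  (forall i : 'I_n, (i < k)%N -> L i = l) ->
  kth_eigenvalue (leaves G) j ((pi / l) ^+ 2).
Proof.
move=> /andP[j1 jk] kn longL; split.
  apply: (multiplicity_ge_leq jk); apply: star_multiplicity => //.
  by rewrite kn andbT (leq_trans _ jk)// ltnW.
by move=> /(multiplicity_ge_leq j1)/star_simple.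
Qed.

End DirichletStar.

(** The Dirichlet center decouples the edges: each carries its own sine, and below [(pi / l) ^+ 2] a
    solution vanishing at the center is 0. *)
Lemma decoupled_star_eigenvalue j : (forall i, L i = l) -> (0 < j <= n)%N ->
  kth_eigenvalue [set: vertex G]%SET j ((pi / l) ^+ 2).
Proof.
move=> Ll /andP[j0 jn]; split.
  apply: (multiplicity_ge_leq jn).
  pose B (m e : 'I_n) : R := (e == m)%:R.
  exists (fun (m : 'I_n) (e : edge G) t => (trig (pi / l) 0 (B m e) t)%:C); last first.
    move=> m; exists ((pi / l) ^+ 2); first exact: lexx.
    apply: (@sine_eigenfunction _ _ m) => //.
    - by left; rewrite inE.
    - by rewrite /B eqxx oner_eq0.
  move=> c hc m.
  have := hc m (l / 2); rewrite {1}/len /= Ll.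
  rewrite half_l.
  move=> /(_ isT).
  have s1 : sin (pi / l * (l / 2)) = 1 :> R.
    by rewrite (_ : pi / l * (l / 2) = pi / 2) ?sin_pihalf//; field; rewrite gt_eqF.
  rewrite (bigD1 m) //= big1 ?addr0.
    by rewrite /trig /B /= eqxx s1 mul0r add0r !mulr1.
  by move=> m' /negbTE mm'; rewrite /trig /B /= eq_sym mm' !mul0r addr0 mulr0.
move=> /(multiplicity_ge_leq j0)/multiplicity_ge1P[lam /= lamlt [f fl]].
have outD i : outer i \in [set: vertex G]%SET by rewrite inE.
have [w [u [x [w_gt0 wl lamE hu nz]]]] := low_eigenfunction outD fl lamlt.
apply: nz; rewrite lamE in hu; apply: (star_weak_solution w_gt0 wl outD hu).
by have [du [_ _ ->//] _] := hu; rewrite inE.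
Qed.

End Star.

(** * Ratios of eigenvalues: attained values, lower bound and infimum *)

Section Proposition.
Context {R : realType}.

Lemma equilateral_star_ratio k j (l : R) (l_gt0 : 0 < l) : (1 < j < k)%N ->
  is_tree (star k l_gt0) /\ eigenvalue_ratio (leaves (star k l_gt0)) k j 1.
Proof.
move=> /andP[j1 jk]; have k1 : (1 < k)%N by exact: ltn_trans jk.
have k0 : (0 < k)%N by exact: ltnW.
have p0 := @pi_gt0 R.
pose L (i : 'I_k) : R := l.
pose L0 (i : 'I_k) : 0 < L i := l_gt0.
have Lle i : L i <= l by exact: lexx.
have tG := metric_star_tree L0.
(* The ground frequency of the equilateral star: every cotangent vanishes at [pi / 2]. *)
pose w := pi / 2 / l.
have w0 : 0 < w by rewrite !divr_gt0.
have wl : w * l = pi / 2 by rewrite /w divfK// gt_eqF.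
have wlt : w * l < pi by rewrite wl; lra.
have wcot : cot_sum L w = 0.
  by rewrite /cot_sum big1// => i _; rewrite wl cos_pihalf mul0r.
have kth m : (1 < m <= k)%N -> kth_eigenvalue (leaves (metric_star L0)) m ((pi / l) ^+ 2).
  by move=> mk; apply: (star_kth_eigenvalue L0 l_gt0 (Ordinal k0) Lle k1 w0 wlt wcot mk).
split; first exact: tG.
exists ((pi / l) ^+ 2), ((pi / l) ^+ 2); split.
- by apply: kth; rewrite k1 leqnn.
- by apply: kth; rewrite j1 ltnW.
- by rewrite divff// expf_neq0// gt_eqF// divr_gt0.
Qed.

Lemma decoupled_star_ratio k (l : R) (l_gt0 : 0 < l) : (0 < k)%N ->
  is_tree (star k l_gt0) /\
  eigenvalue_ratio [set: vertex (star k l_gt0)]%SET k 1 1.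
Proof.
move=> k0; pose L0 (i : 'I_k) : 0 < (fun _ : 'I_k => l) i := l_gt0.
have kth m : (0 < m <= k)%N ->
    kth_eigenvalue [set: vertex (metric_star L0)]%SET m ((pi / l) ^+ 2).
  by move=> mk; apply: (decoupled_star_eigenvalue L0 l_gt0 (Ordinal k0)) => // i; exact: lexx.
split; first exact: (metric_star_tree L0).
exists ((pi / l) ^+ 2), ((pi / l) ^+ 2); split.
- by apply: kth; rewrite k0 leqnn.
- by apply: kth.
- by rewrite divff// expf_neq0// gt_eqF// divr_gt0// pi_gt0.
Qed.

(* A star with [k] edges of length [pi] and one short edge whose length is
   tuned so that [w ^+ 2] is the first eigenvalue: as [w] tends to 1 the short
   edge shrinks and imposes a Dirichlet condition at the center. *)
Lemma perturbed_star_ratio k (w : R) : (1 < k)%N -> 2^-1 < w < 1 ->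
  dirichlet_tree_ratios k 1 (w ^- 2).
Proof.
move=> k1 /andP[w12 w1]; have p0 := @pi_gt0 R.
have k0 : (0 < k)%N by exact: ltnW.
have w0 : 0 < w by lra.
pose a := w * pi.
have api : a < pi by rewrite /a gtr_pMl.
have pia : pi / 2 < a by rewrite /a mulrC ltr_pM2r.
have sa : 0 < sin a by rewrite sin_gt0_pi// api andbT; lra.
have ca : cos a < 0.
  rewrite -(subrK (pi / 2) a) cosDpihalf oppr_lt0 sin_gt0_pi//.
  by apply/andP; split; lra.
have kR : 0 < k%:R :> R by rewrite ltr0n.
(* The secular equation is [k * cot a + cot (w * eps) = 0]; it holds when [tan (w * eps) = z], and
   [z] is positive since [a] lies between [pi / 2] and [pi]. *)
pose z := - (tan a) / k%:R.
have z0 : 0 < z.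
  rewrite /z divr_gt0// oppr_gt0 /tan.
  by rewrite pmulr_rlt0// invr_lt0.
pose eps := atan z / w.
have az0 : 0 < atan z by rewrite -(@atan0 R) lt_atan.
have azpi : atan z < pi / 2 by exact: atan_ltpi2.
have eps0 : 0 < eps by rewrite divr_gt0.
(* As [w > 1 / 2], the tuned edge is no longer than the others, so [pi] is the greatest length. *)
have epspi : eps <= pi.
  rewrite ler_pdivrMr//; apply/ltW; apply: lt_trans azpi _.
  by rewrite [pi * w]mulrC.
pose L (i : 'I_k.+1) : R := if (i < k)%N then pi else eps.
have L0 i : 0 < L i by rewrite /L; case: ifP.
have Lle i : L i <= pi by rewrite /L; case: ifP.
have k2 : (1 < k.+1)%N by exact: ltnW.
have wcot : cot_sum L w = 0.
  rewrite /cot_sum big_ord_recr /= /L ltnn.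
  rewrite (eq_bigr (fun=> cos a / sin a)) => [|i _]; last by rewrite /= ltn_ord.
  rewrite sumr_const card_ord.
  have -> : w * eps = atan z by rewrite /eps mulrC divfK// gt_eqF.
  have -> : cos (atan z) / sin (atan z) = z^-1.
    by rewrite -{3}(atanK z) /tan invf_div.
  rewrite /z /tan -mulr_natr; field.
  by rewrite (gt_eqF kR) (lt_eqF ca) (gt_eqF sa).
have kth m := star_kth_eigenvalue L0 p0 ord0 Lle k2 w0 api wcot (k := k) (j := m).
exists (metric_star L0); first exact: metric_star_tree.
exists ((pi / pi) ^+ 2), (w ^+ 2); split.
- apply: kth; rewrite ?k1 ?leqnn ?leqnSn// => i ik; by rewrite /L ik.
- exact: (star_first_eigenvalue L0 p0 ord0 Lle k2 w0 api wcot).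
- by rewrite divff ?gt_eqF// expr1n div1r.
Qed.

Lemma no_edge_no_eigenvalue (G : metric_graph R) VD k r :
  (0 < k)%N -> kth_eigenvalue (G := G) VD k r -> exists e : edge G, True.
Proof.
move=> k0 [/(multiplicity_ge_leq k0)/multiplicity_ge1P[lam _ [f [[e _] _]]] _].
by exists e.
Qed.

Lemma dirichlet_tree_ratio_ge1 k j (r : R) : (0 < j <= k)%N ->
  dirichlet_tree_ratios k j r -> 1 <= r.
Proof.
move=> jk [G tG hr]; have [j0 _] := andP jk.
have [e _] : exists e : edge G, True.
  by have [lk [lj [_ /no_edge_no_eigenvalue h _]]] := hr; exact: h.
have [v vD] := tree_leaf e tG.
exact: eigenvalue_ratio_ge1 vD jk hr.
Qed.

(** If [VD] consisted of the leaves only, ratio 1 with [k >= 2] would give two independent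
    eigenfunctions for the first eigenvalue, against its simplicity. *)
Lemma ratio1_interior_dirichlet k (G : metric_graph R) (VD : {set vertex G}) :
  (1 < k)%N -> is_tree G -> leaves G \subset VD -> eigenvalue_ratio VD k 1 1 ->
  exists2 v, v \in VD & v \notin leaves G.
Proof.
move=> k1 tG lVD hr; apply: contrapT => hn.
have {lVD hn} VDE : VD = leaves G.
  apply/eqP; rewrite finset.eqEsubset lVD andbT; apply/fintype.subsetP => v vD.
  by apply/negPn/negP => vl; apply: hn; exists v.
subst VD; have [lk [l1 [[hk _] [h1 h1'] r1]]] := hr.
have [e _] := no_edge_no_eigenvalue (ltnSn 0) (conj h1 h1').
have [v0 v0D] := tree_leaf e tG.
have l1_gt0 : 0 < l1.
  have /multiplicity_ge1P [lam laml1 [f fl]] := h1.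
  exact: lt_le_trans (eigenfunction_gt0 v0D fl) laml1.
have lkE : lk = l1 by rewrite -[LHS](divfK (lt0r_neq0 l1_gt0)) -r1 mul1r.
have [f fi fA] := multiplicity_ge_leq k1 hk.
have w0 : 0 < Num.sqrt l1 by rewrite sqrtr_gt0.
have w2 : Num.sqrt l1 ^+ 2 = l1 by rewrite sqr_sqrtr// ltW.
(* The eigenvalue of [f i] is at most [lk = l1], and it cannot be smaller since nothing lies below
   [l1]. *)
have fl i : eigenfunction (leaves G) (Num.sqrt l1 ^+ 2) (f i).
  have [lam /= lamle fl] := fA i; rewrite w2.
  suff -> : l1 = lam by [].
  apply/eqP; rewrite eq_le -lkE lamle andbT lkE leNgt; apply/negP => lt.
  by apply: h1'; apply/multiplicity_ge1P; exists lam => //; exists (f i).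
have first : ~ multiplicity_ge (leaves G) [set x | x < Num.sqrt l1 ^+ 2] 1.
  by rewrite w2.
have [e' [p [pl inj]]] := tree_simple w0 first e tG.
exact: (simple_eigenvalue pl inj fi fl).
Qed.

(** For [j >= 2] the lower bound 1 is attained on a star; for [j = 1] the perturbed stars give
    ratios [w ^- 2] arbitrarily close to 1. *)
Lemma inf_dirichlet_tree_ratios k j : (1 <= j)%N -> (j < k)%N ->
  inf (dirichlet_tree_ratios k j : set R) = 1.
Proof.
move=> j1 jk.
have lb1 : lbound (dirichlet_tree_ratios k j : set R) 1.
  by move=> r; apply: dirichlet_tree_ratio_ge1; rewrite j1 ltnW.
have k1 : (1 < k)%N by exact: leq_ltn_trans jk.
have hlb : has_lbound (dirichlet_tree_ratios k j : set R) by exists 1.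
have [j2|] := ltnP 1 j.
  have in1 : dirichlet_tree_ratios k j (1 : R).
    have [|t r] := equilateral_star_ratio (k := k) (j := j) (@ltr01 R); first by rewrite j2.
    by exists (star k (@ltr01 R)).
  apply/eqP; rewrite eq_le ge_inf//=.
  by apply: lb_le_inf => //; exists 1.
move=> j1'; have {j1 j1'} jE : j = 1%N by apply/eqP; rewrite eqn_leq j1' j1.
subst j; set S := dirichlet_tree_ratios k 1 in lb1 hlb *.
have inS (w : R) : 2^-1 < w < 1 -> S (w ^- 2) by exact: perturbed_star_ratio.
have S0 : S !=set0.
  by exists ((3 / 4) ^- 2); apply: inS; apply/andP; split; lra.
apply/eqP; rewrite eq_le lb_le_inf// andbT leNgt; apply/negP => i1.
set q := (inf S)^-1.
have q0 : 0 < q by rewrite invr_gt0 (lt_trans ltr01).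
have q1 : q < 1 by rewrite invf_lt1// (lt_trans ltr01).
(* Here [w ^+ 2 - q = ((1 - q) / 2) ^+ 2 > 0], so [w ^- 2] falls below the supposed infimum
   [q^-1]. *)
pose w := (1 + q) / 2.
have w12 : 2^-1 < w < 1 by rewrite /w; apply/andP; split; lra.
have qw : q < w ^+ 2 by rewrite /w; nra.
have := ge_inf hlb (inS _ w12); rewrite leNgt => /negP; apply.
by rewrite -[ltRHS]invrK ltf_pV2// posrE ?exprn_gt0//; lra.
Qed.

End Proposition.

Theorem proposition1p9 (R : realType) (k j : nat)
    (j_ge1 : (1 <= j)%N) (lt_jk : (j < k)%N) :
  [/\ inf (dirichlet_tree_ratios k j : set R) = 1,
      (2 <= j)%N -> forall (l : R) (l_gt0 : 0 < l),
        is_tree (star k l_gt0) /\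
        eigenvalue_ratio (leaves (star k l_gt0)) k j 1
    & j = 1%N ->
        (forall (G : metric_graph R) (VD : {set vertex G}),
           is_tree G -> leaves G \subset VD ->
           eigenvalue_ratio VD k j 1 ->
           exists2 v, v \in VD & v \notin leaves G) /\
        (forall (l : R) (l_gt0 : 0 < l),
           is_tree (star k l_gt0) /\
           eigenvalue_ratio [set: vertex (star k l_gt0)]%SET k j 1)].
Proof.
split; first exact: inf_dirichlet_tree_ratios.
  by move=> j2 l l_gt0; apply: equilateral_star_ratio; rewrite j2.
move=> jE; subst j; split.
  by move=> G VD; exact: ratio1_interior_dirichlet.
by move=> l l_gt0; apply: decoupled_star_ratio; exact: ltn_trans lt_jk.
Qed.
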